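(* (i) There is an isomorphism $\mathbf{S}(\pi)\to\mathbf{T}(\pi)$ of $\mathbb{Q}(v)$-algebras sending $E_i$ to $E_i$, $F_i$ to $F_i$ ($1\le i\le n$), and $1_\lambda$ to $1_\lambda$ ($\lambda\in W\pi$). (ii) This isomorphism carries ${}_{\mathcal{A}}\mathbf{S}(\pi)$ onto ${}_{\mathcal{A}}\mathbf{T}(\pi)$, where ${}_{\mathcal{A}}\mathbf{T}(\pi)$ is identified with the $\mathcal{A}$-submodule of $\mathbf{T}(\pi)$ spanned by all elements $1\otimes x$ with $x\in{}_{\mathcal{A}}\mathbf{T}(\pi)$.
   Context: Root data. Let $(a_{ij})_{1\le i,j\le n}$ be a Cartan matrix of finite type (not assumed indecomposable): integers with $a_{ii}=2$, $a_{ij}\le 0$ for $i\ne j$, and there are $d_i\in\{1,2,3\}$ with $(d_ia_{ij})$ symmetric and positive definite. Let $\mathfrak{g}$ be the corresponding semisimple Lie algebra over $\mathbb{Q}$, $\mathfrak{h}$ its Cartan subalgebra, $\alpha_i\in\mathfrak{h}^*$ the simple roots, $\alpha_i^\vee\in\mathfrak{h}$ the simple coroots, $\langle\alpha_i^\vee,\alpha_j\rangle=a_{ij}$, $W$ the Weyl group. Let $X=\{\lambda\in\mathfrak{h}^*\mid\langle\alpha_i^\vee,\lambda\rangle\in\mathbb{Z}\ \forall i\}$, $X^+=\{\lambda\in X\mid\langle\alpha_i^\vee,\lambda\rangle\ge0\ \forall i\}$, and write $\lambda\le\mu$ if $\mu-\lambda\in\sum_i\mathbb{N}\alpha_i$.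 Let $\pi\subset X^+$ be a finite saturated set, i.e. $\mu\in\pi$, $\lambda\in X^+$, $\lambda\le\mu$ imply $\lambda\in\pi$. Let $W\pi=\{w\mu\mid w\in W,\mu\in\pi\}$. Quantum notation. $v$ is an indeterminate, $\mathcal{A}=\mathbb{Z}[v,v^{-1}]$, $v_i=v^{d_i}$, $[a]_i=(v_i^a-v_i^{-a})/(v_i-v_i^{-1})$, $[t]_i^!=\prod_{s=1}^t[s]_i$, $\begin{bmatrix}a\\t\end{bmatrix}_i=\prod_{s=0}^{t-1}(v_i^{a-s}-v_i^{-a+s})/\prod_{s=1}^t(v_i^s-v_i^{-s})$ for $a\in\mathbb{Z}$, $t\in\mathbb{N}$. The algebra $\mathbf{S}(\pi)$. It is the associative unital $\mathbb{Q}(v)$-algebra with generators $E_i,F_i$ ($1\le i\le n$), $1_\lambda$ ($\lambda\in W\pi$) and relations: $1_\lambda1_\mu=\delta_{\lambda\mu}1_\lambda$, $\sum_{\lambda\in W\pi}1_\lambda=1$; $E_iF_j-F_jE_i=\delta_{ij}\sum_{\lambda\in W\pi}[\langle\alpha_i^\vee,\lambda\rangle]_i1_\lambda$; $E_i1_\lambda=1_{\lambda+\alpha_i}E_i$ if $\lambda+\alpha_i\in W\pi$ and $E_i1_\lambda=0$ otherwise; $F_i1_\lambda=1_{\lambda-\alpha_i}F_i$ if $\lambda-\alpha_i\in W\pi$ and $F_i1_\lambda=0$ otherwise; $1_\lambda E_i=E_i1_{\lambda-\alpha_i}$ if $\lambda-\alpha_i\in W\pi$ and $1_\lambda E_i=0$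 otherwise; $1_\lambda F_i=F_i1_{\lambda+\alpha_i}$ if $\lambda+\alpha_i\in W\pi$ and $1_\lambda F_i=0$ otherwise; and for $i\ne j$ the quantum Serre relations $\sum_{s=0}^{1-a_{ij}}(-1)^s\begin{bmatrix}1-a_{ij}\\ s\end{bmatrix}_iE_i^{1-a_{ij}-s}E_jE_i^s=0$ and the same with $F$ in place of $E$. ${}_{\mathcal{A}}\mathbf{S}(\pi)$ is the $\mathcal{A}$-subalgebra of $\mathbf{S}(\pi)$ generated by all $1_\lambda$ ($\lambda\in W\pi$), $E_i^m/[m]_i^!$, $F_i^m/[m]_i^!$ ($1\le i\le n$, $m\ge0$). The algebra ${}_{\mathcal{A}}\mathbf{T}(\pi)$. It is the associative unital $\mathcal{A}$-algebra with generators $E_i^{(a)},F_i^{(b)}$ ($1\le i\le n$, $a,b\ge0$), $1_\lambda$ ($\lambda\in W\pi$) and the following relations, where by convention $1_\mu=0$ for $\mu\in X\setminus W\pi$, and $E_i^{(m)}=F_i^{(m)}=0$ for $m<0$: $1_\lambda1_\mu=\delta_{\lambda\mu}1_\lambda$, $\sum_{\lambda\in W\pi}1_\lambda=1$; $E_i^{(a)}E_i^{(b)}=\begin{bmatrix}a+b\\ a\end{bmatrix}_iE_i^{(a+b)}$, $F_i^{(a)}F_i^{(b)}=\begin{bmatrix}a+b\\ a\end{bmatrix}_iF_i^{(a+b)}$, $E_i^{(0)}=F_i^{(0)}=1$; $E_i^{(a)}F_j^{(b)}=F_j^{(b)}E_i^{(a)}$ ($i\ne j$); $E_i^{(a)}1_{-\lambda}F_i^{(b)}=\sum_{t\ge0}\begin{bmatrix}a+b-\langle\alpha_i^\vee,\lambda\rangle\\t\end{bmatrix}_iF_i^{(b-t)}1_{-\lambda+(a+b-t)\alpha_i}E_i^{(a-t)}$;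 $F_i^{(b)}1_\lambda E_i^{(a)}=\sum_{t\ge0}\begin{bmatrix}a+b-\langle\alpha_i^\vee,\lambda\rangle\\t\end{bmatrix}_iE_i^{(a-t)}1_{\lambda-(a+b-t)\alpha_i}F_i^{(b-t)}$; $E_i^{(a)}1_\lambda=1_{\lambda+a\alpha_i}E_i^{(a)}$ if $\lambda+a\alpha_i\in W\pi$, and $0$ otherwise; $F_i^{(b)}1_\lambda=1_{\lambda-b\alpha_i}F_i^{(b)}$ if $\lambda-b\alpha_i\in W\pi$, and $0$ otherwise; $1_\lambda E_i^{(a)}=E_i^{(a)}1_{\lambda-a\alpha_i}$ if $\lambda-a\alpha_i\in W\pi$, and $0$ otherwise; $1_\lambda F_i^{(b)}=F_i^{(b)}1_{\lambda+b\alpha_i}$ if $\lambda+b\alpha_i\in W\pi$, and $0$ otherwise; and for $i\ne j$: $\sum_{s=0}^{1-a_{ij}}(-1)^sE_i^{(1-a_{ij}-s)}E_j^{(1)}E_i^{(s)}=0$ and $\sum_{s=0}^{1-a_{ij}}(-1)^sF_i^{(1-a_{ij}-s)}F_j^{(1)}F_i^{(s)}=0$. $\mathbf{T}(\pi)=\mathbb{Q}(v)\otimes_{\mathcal{A}}{}_{\mathcal{A}}\mathbf{T}(\pi)$; in $\mathbf{T}(\pi)$ write $E_i=E_i^{(1)}$, $F_i=F_i^{(1)}$. *)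

(* Defs.v *)
From HB Require Import structures.
From mathcomp Require Import all_boot all_order all_algebra.
From mathcomp Require Import generic_quotient ring_quotient.
From mathcomp Require Import finmap boolp classical_sets functions cardinality.
From mathcomp Require Import fsbigop.
From mathcomp Require Import monalg.
From mathcomp Require Import ring.

Set Implicit Arguments.
Unset Strict Implicit.
Unset Printing Implicit Defensive.

Import Order.TTheory GRing.Theory Num.Theory.
Local Open Scope ring_scope.
Local Open Scope classical_set_scope.
Local Open Scope quotient_scope.

(* The algebras below can be zero (take pi empty), whereas algType requires
   1 != 0; they are given their pzRingType and lmodType structures instead,
   with scalars shown to be central in palg_scaler* and tensor_scaler*.       *)


Notation free_alg R G := {malg R[{fmonom G}]}.

Definition fgen (R : comNzRingType) (G : choiceType) (g : G) : free_alg R G :=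
  << fmu g >>.

Section Presented.
Variables (R : comNzRingType) (G : choiceType).
Local Notation F := (free_alg R G).

Lemma free_scalerAr (a : R) (x y : F) : a *: (x * y) = x * (a *: y).
Proof.
rewrite -[in RHS]mul_malgC mulrA.
suff -> : x * a%:MP = a%:MP * x by rewrite -mulrA mul_malgC.
apply/malgP => k.
have le1 : (msupp (a%:MP : {malg R[{fmonom G}]}) `<=` [fset (@mone {fmonom G})])%fset.
  exact: msuppU_le.
apply: etrans (mcoeffMlw k (fsubset_refl _) le1) _.
apply: etrans (esym (mcoeffMrw k le1 (fsubset_refl _))).
by apply: eq_bigr => m _; rewrite !big_seq_fset1 mulrC mulm1 mul1m.
Qed.

Variable rel : F -> F -> Prop.

Inductive in_ideal : F -> Prop :=
| in_ideal0 : in_ideal 0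
| in_ideal_rel a x y b : rel x y -> in_ideal (a * (x - y) * b)
| in_idealD x y : in_ideal x -> in_ideal y -> in_ideal (x + y)
| in_idealN x : in_ideal x -> in_ideal (- x).

Lemma in_idealMl a x : in_ideal x -> in_ideal (a * x).
Proof.
elim=> [|c y z b r|y z _ Iy _ Iz|y _ Iy].
- by rewrite mulr0; exact: in_ideal0.
- by rewrite !mulrA; exact: in_ideal_rel.
- by rewrite mulrDr; exact: in_idealD.
- by rewrite mulrN; exact: in_idealN.
Qed.

Lemma in_idealMr a x : in_ideal x -> in_ideal (x * a).
Proof.
elim=> [|c y z b r|y z _ Iy _ Iz|y _ Iy].
- by rewrite mul0r; exact: in_ideal0.
- by rewrite -mulrA; exact: in_ideal_rel.
- by rewrite mulrDl; exact: in_idealD.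
- by rewrite mulNr; exact: in_idealN.
Qed.

Definition ideal_pred : {pred F} := fun x => `[< in_ideal x >].

Lemma ideal_predP x : reflect (in_ideal x) (x \in ideal_pred).
Proof. exact: asboolP. Qed.

Lemma ideal_pred_zmod : zmod_closed ideal_pred.
Proof.
split=> [|x y /ideal_predP Ix /ideal_predP Iy]; apply/ideal_predP.
  exact: in_ideal0.
by apply: in_idealD => //; apply: in_idealN.
Qed.

HB.instance Definition _ := GRing.isZmodClosed.Build F ideal_pred ideal_pred_zmod.

Definition palg : Type := Quotient.quot (ideal_pred : zmodClosed F).
HB.instance Definition _ := GRing.Zmodule.on palg.
HB.instance Definition _ := EqQuotient.on palg.

Definition ppi (x : F) : palg := \pi_palg x.

Lemma ppiP (x y : F) : ppi x = ppi y <-> in_ideal (x - y).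
Proof.
rewrite /ppi; split=> [/eqP|].
  by rewrite -[_ == _]Quotient.idealrBE => /ideal_predP.
by move=> /ideal_predP; rewrite Quotient.idealrBE => /eqP.
Qed.

Lemma palgW (P : palg -> Prop) : (forall x, P (ppi x)) -> forall u, P u.
Proof. exact: quotW. Qed.

Lemma ppiB x y : ppi (x - y) = ppi x - ppi y.
Proof. by rewrite /ppi !piE. Qed.

Definition palg_one : palg := ppi 1.
Definition palg_mul : palg -> palg -> palg :=
  locked (fun u v => ppi (repr u * repr v)).
Definition palg_scale : R -> palg -> palg :=
  locked (fun a u => ppi (a *: repr u)).

Lemma ppi_repr (u : palg) : ppi (repr u) = u.
Proof. exact: reprK. Qed.

Lemma ppi_mul x y : palg_mul (ppi x) (ppi y) = ppi (x * y).
Proof.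
rewrite /palg_mul -lock; apply/ppiP; set x' := repr _; set y' := repr _.
have /ppiP Ix : ppi x' = ppi x by exact: ppi_repr.
have /ppiP Iy : ppi y' = ppi y by exact: ppi_repr.
have -> : x' * y' - x * y = (x' - x) * y' + x * (y' - y).
  by rewrite mulrBl mulrBr addrA addrNK.
by apply: in_idealD; [apply: in_idealMr | apply: in_idealMl].
Qed.

Lemma ppi_scale a x : palg_scale a (ppi x) = ppi (a *: x).
Proof.
rewrite /palg_scale -lock; apply/ppiP; rewrite -scalerBr -mul_malgC; apply: in_idealMl.
by apply/ppiP; exact: ppi_repr.
Qed.

Lemma ppiD x y : ppi (x + y) = ppi x + ppi y.
Proof. by rewrite /ppi !piE. Qed.

Lemma palg_mulA : associative palg_mul.
Proof.
by elim/palgW=> x; elim/palgW=> y; elim/palgW=> z; rewrite !ppi_mul mulrA.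
Qed.
Lemma palg_mul1r : left_id palg_one palg_mul.
Proof. by elim/palgW=> x; rewrite ppi_mul mul1r. Qed.
Lemma palg_mulr1 : right_id palg_one palg_mul.
Proof. by elim/palgW=> x; rewrite ppi_mul mulr1. Qed.
Lemma palg_mulDl : left_distributive palg_mul +%R.
Proof.
elim/palgW=> x; elim/palgW=> y; elim/palgW=> z.
by rewrite -ppiD !ppi_mul mulrDl ppiD.
Qed.
Lemma palg_mulDr : right_distributive palg_mul +%R.
Proof.
elim/palgW=> x; elim/palgW=> y; elim/palgW=> z.
by rewrite -ppiD !ppi_mul mulrDr ppiD.
Qed.

HB.instance Definition _ := GRing.Zmodule_isPzRing.Build palg
  palg_mulA palg_mul1r palg_mulr1 palg_mulDl palg_mulDr.

Lemma palg_scaleA a b u :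
  palg_scale a (palg_scale b u) = palg_scale (a * b) u.
Proof. by elim/palgW: u => x; rewrite !ppi_scale scalerA. Qed.
Lemma palg_scale1 : left_id 1 palg_scale.
Proof. by elim/palgW=> x; rewrite ppi_scale scale1r. Qed.
Lemma palg_scaleDr : right_distributive palg_scale +%R.
Proof.
by move=> a; elim/palgW=> x; elim/palgW=> y; rewrite -ppiD !ppi_scale scalerDr ppiD.
Qed.
Lemma palg_scaleDl u : {morph palg_scale^~ u : a b / a + b}.
Proof. by elim/palgW: u => x a b; rewrite !ppi_scale scalerDl ppiD. Qed.

HB.instance Definition _ := GRing.Zmodule_isLmodule.Build R palg
  palg_scaleA palg_scale1 palg_scaleDr palg_scaleDl.

Lemma palg_scalerAl (a : R) (u v : palg) : a *: (u * v) = (a *: u) * v.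
Proof.
elim/palgW: u => x; elim/palgW: v => y; rewrite /GRing.scale /GRing.mul /=.
by rewrite !(ppi_mul, ppi_scale) scalerAl.
Qed.

Lemma palg_scalerAr (a : R) (u v : palg) : a *: (u * v) = u * (a *: v).
Proof.
elim/palgW: u => x; elim/palgW: v => y; rewrite /GRing.scale /GRing.mul /=.
by rewrite !(ppi_mul, ppi_scale) free_scalerAr.
Qed.

Lemma ppi_is_linear : linear ppi.
Proof. by move=> a x y; rewrite ppiD -ppi_scale. Qed.
HB.instance Definition _ := GRing.isLinear.Build R F palg *:%R ppi ppi_is_linear.

Lemma ppi_is_monoid_morphism : monoid_morphism ppi.
Proof. by split=> [|x y]; [exact: erefl | exact: esym (ppi_mul x y)]. Qed.
HB.instance Definition _ :=
  GRing.isMonoidMorphism.Build F palg ppi ppi_is_monoid_morphism.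

Lemma ppi_rel x y : rel x y -> ppi x = ppi y.
Proof.
move=> r; apply/ppiP; rewrite -[x - y]mul1r -[_ * _]mulr1.
exact: in_ideal_rel.
Qed.
End Presented.


(* Formal finite sums of pure tensors a (x) m, up to the bilinear relations. *)
Section TensorModule.
Variables (A K : comNzRingType) (phi : {rmorphism A -> K}) (M : lmodType A).

Inductive tensor_eq : seq (K * M) -> seq (K * M) -> Prop :=
| tensor_refl s : tensor_eq s s
| tensor_sym s t : tensor_eq s t -> tensor_eq t s
| tensor_trans t s u : tensor_eq s t -> tensor_eq t u -> tensor_eq s u
| tensor_cat s s' t t' :
    tensor_eq s s' -> tensor_eq t t' -> tensor_eq (s ++ t) (s' ++ t')
| tensor_catC s t : tensor_eq (s ++ t) (t ++ s)
| tensor_0l m : tensor_eq [:: (0, m)] [::]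
| tensor_Dl a b m : tensor_eq [:: (a + b, m)] [:: (a, m); (b, m)]
| tensor_Dr a m m' : tensor_eq [:: (a, m + m')] [:: (a, m); (a, m')]
| tensor_Z a r m : tensor_eq [:: (a * phi r, m)] [:: (a, r *: m)].

Definition tensor_eqb : rel (seq (K * M)) := fun s t => `[< tensor_eq s t >].

Lemma tensor_eqb_equiv : equiv_class_of tensor_eqb.
Proof.
split=> [s|s t|t s u]; first exact/asboolP/tensor_refl.
  by apply/asboolP/asboolP; exact: tensor_sym.
by move=> /asboolP st /asboolP tu; apply/asboolP; exact: tensor_trans tu.
Qed.

Canonical tensor_equiv := EquivRelPack tensor_eqb_equiv.
Canonical tensor_encModRel := defaultEncModRel tensor_eqb.

Definition tensor : Type := {eq_quot tensor_eqb}.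
HB.instance Definition _ : EqQuotient _ tensor_eqb tensor :=
  EqQuotient.on tensor.
HB.instance Definition _ := Choice.on tensor.

Definition tpi (s : seq (K * M)) : tensor := \pi_tensor s.
Definition pure (a : K) (m : M) : tensor := tpi [:: (a, m)].

Lemma tpiP s t : tpi s = tpi t <-> tensor_eq s t.
Proof. by split=> [/eqmodP/asboolP | st]; last exact/eqmodP/asboolP. Qed.

Lemma tpi_repr (u : tensor) : tpi (repr u) = u.
Proof. exact: reprK. Qed.

Lemma tensorW (P : tensor -> Prop) : (forall s, P (tpi s)) -> forall u, P u.
Proof. exact: quotW. Qed.

Definition zscale (a : K) (s : seq (K * M)) := [seq (a * x.1, x.2) | x <- s].

Lemma zscale_eq a s t : tensor_eq s t -> tensor_eq (zscale a s) (zscale a t).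
Proof.
elim=> [{}s|{}s {}t _ +|{}t {}s u _ + _ +|{}s s' {}t t' _ + _ +|{}s {}t|m
  |b c m|b m m'|b r m]; rewrite /zscale ?map_cat /= ?mulrDr ?mulrA ?mulr0.
- exact: tensor_refl.
- exact: tensor_sym.
- exact: tensor_trans.
- exact: tensor_cat.
- exact: tensor_catC.
- exact: tensor_0l.
- exact: tensor_Dl.
- exact: tensor_Dr.
- exact: tensor_Z.
Qed.

Lemma zscaleN_eq s : tensor_eq (zscale (-1) s ++ s) [::].
Proof.
elim: s => [|[a m] s IHs]; first exact: tensor_refl.
have -> : zscale (-1) ((a, m) :: s) ++ (a, m) :: s
    = [:: (-1 * a, m)] ++ (zscale (-1) s ++ [:: (a, m)]) ++ s.
  by rewrite /= -catA.
apply: (tensor_trans (t := [:: (-1 * a, m)] ++ ([:: (a, m)] ++ zscale (-1) s) ++ s)).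
  apply: tensor_cat; first exact: tensor_refl.
  by apply: tensor_cat; [exact: tensor_catC | exact: tensor_refl].
apply: (@tensor_cat [:: (-1 * a, m); (a, m)] [::] (zscale (-1) s ++ s) [::]) => //.
apply: (tensor_trans (t := [:: (-1 * a + a, m)])).
  by apply: tensor_sym; exact: tensor_Dl.
by rewrite mulN1r addNr; exact: tensor_0l.
Qed.

Definition tadd : tensor -> tensor -> tensor :=
  locked (fun u v => tpi (repr u ++ repr v)).
Definition tscale : K -> tensor -> tensor :=
  locked (fun a u => tpi (zscale a (repr u))).
Definition topp (u : tensor) : tensor := tscale (-1) u.

Lemma tpi_cat s t : tadd (tpi s) (tpi t) = tpi (s ++ t).
Proof. by rewrite /tadd -lock; apply/tpiP/tensor_cat; apply/tpiP; exact: tpi_repr. Qed.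

Lemma tpi_scale a s : tscale a (tpi s) = tpi (zscale a s).
Proof. by rewrite /tscale -lock; apply/tpiP/zscale_eq/tpiP; exact: tpi_repr. Qed.

Lemma taddA : associative tadd.
Proof.
by elim/tensorW=> s; elim/tensorW=> t; elim/tensorW=> u; rewrite !tpi_cat catA.
Qed.
Lemma taddC : commutative tadd.
Proof.
by elim/tensorW=> s; elim/tensorW=> t; rewrite !tpi_cat; apply/tpiP/tensor_catC.
Qed.
Lemma tadd0 : left_id (tpi [::]) tadd.
Proof. by elim/tensorW=> s; rewrite tpi_cat. Qed.
Lemma taddN : left_inverse (tpi [::]) topp tadd.
Proof.
by elim/tensorW=> s; rewrite /topp tpi_scale tpi_cat; apply/tpiP/zscaleN_eq.
Qed.

HB.instance Definition _ := GRing.isZmodule.Build tensor taddA taddC tadd0 taddN.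

Lemma tpiD s t : tpi (s ++ t) = tpi s + tpi t.
Proof. by rewrite -tpi_cat. Qed.

Lemma tscaleA a b u : tscale a (tscale b u) = tscale (a * b) u.
Proof.
elim/tensorW: u => s; rewrite !tpi_scale /zscale -map_comp.
by congr tpi; apply: eq_map => x /=; rewrite mulrA.
Qed.
Lemma tscale1 : left_id 1 tscale.
Proof.
elim/tensorW=> s; rewrite tpi_scale; congr tpi.
by rewrite -[RHS]map_id; apply: eq_map => -[a m]; rewrite /= mul1r.
Qed.
Lemma tscaleDr : right_distributive tscale +%R.
Proof.
move=> a; elim/tensorW=> s; elim/tensorW=> t.
by rewrite -tpiD !tpi_scale -tpiD /zscale map_cat.
Qed.
Lemma tscaleDl u : {morph tscale^~ u : a b / a + b}.
Proof.
elim/tensorW: u => s a b; rewrite !tpi_scale -tpiD; apply/tpiP.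
elim: s => [|[c m] s IHs]; first exact: tensor_refl.
apply: (tensor_trans (t := [:: (a * c, m); (b * c, m)] ++ (zscale a s ++ zscale b s))).
  apply: (@tensor_cat [:: ((a + b) * c, m)] _ _ _ _ IHs).
  by rewrite mulrDl; exact: tensor_Dl.
set x := (b * c, m); set sa := zscale a s; set sb := zscale b s.
change (tensor_eq ([:: (a * c, m)] ++ (x :: sa ++ sb))
                  ([:: (a * c, m)] ++ (sa ++ x :: sb))).
apply: tensor_cat.
  exact: tensor_refl.
rewrite -cat_rcons -cats1.
apply: (@tensor_cat (x :: sa) _ sb sb); last exact: tensor_refl.
exact: (tensor_catC [:: x] sa).
Qed.

HB.instance Definition _ := GRing.Zmodule_isLmodule.Build K tensor
  tscaleA tscale1 tscaleDr tscaleDl.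
End TensorModule.

Section TensorAlgebra.
Variables (A K : comNzRingType) (phi : {rmorphism A -> K}).
Variables (G : choiceType) (rel : free_alg A G -> free_alg A G -> Prop).
Local Notation B := (palg rel).
Local Notation T := (tensor phi B).
Local Notation teq := (tensor_eq phi (M := B)).

Definition zmul (s t : seq (K * B)) : seq (K * B) :=
  [seq (x.1 * y.1, x.2 * y.2) | x <- s, y <- t].

Lemma zmul_catl s s' t : zmul (s ++ s') t = zmul s t ++ zmul s' t.
Proof. exact: allpairs_cat. Qed.

Lemma zmul1s x t : zmul [:: x] t = [seq (x.1 * y.1, x.2 * y.2) | y <- t].
Proof. exact: cats0. Qed.

Lemma zmul_cons x s t : zmul (x :: s) t = zmul [:: x] t ++ zmul s t.
Proof. by rewrite -cat1s zmul_catl. Qed.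

Lemma zmul1_cat x s t : zmul [:: x] (s ++ t) = zmul [:: x] s ++ zmul [:: x] t.
Proof. by rewrite !zmul1s map_cat. Qed.

Lemma tensor_catCA s t u : teq (s ++ t ++ u) (t ++ s ++ u).
Proof.
rewrite !catA; apply: (@tensor_cat _ _ phi B (s ++ t) (t ++ s) u u).
  exact: tensor_catC.
exact: tensor_refl.
Qed.

Lemma tensor_catACA s t u w : teq ((s ++ t) ++ (u ++ w)) ((s ++ u) ++ (t ++ w)).
Proof.
rewrite -!catA; apply: tensor_cat; first exact: tensor_refl.
exact: tensor_catCA.
Qed.

Lemma zmul_catr s t u : teq (zmul s (t ++ u)) (zmul s t ++ zmul s u).
Proof.
elim: s => [|x s IHs]; first exact: tensor_refl.
rewrite !(zmul_cons x s) zmul1_cat.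
apply: tensor_trans (tensor_catACA _ _ _ _).
by apply: tensor_cat => //; exact: tensor_refl.
Qed.

Lemma zmul1_eq x s t : teq s t -> teq (zmul [:: x] s) (zmul [:: x] t).
Proof.
case: x => c b; elim=> [{}s|{}s {}t _ +|{}t {}s u _ + _ +|{}s s' {}t t' _ + _ +
  |{}s {}t|m|a a' m|a m m'|a r m]; rewrite ?zmul1_cat ?zmul1s /=.
- exact: tensor_refl.
- exact: tensor_sym.
- exact: tensor_trans.
- exact: tensor_cat.
- exact: tensor_catC.
- by rewrite mulr0; exact: tensor_0l.
- by rewrite mulrDr; exact: tensor_Dl.
- by rewrite mulrDr; exact: tensor_Dr.
- by rewrite mulrA -palg_scalerAr; exact: tensor_Z.
Qed.

Lemma zmulr_eq s t u : teq t u -> teq (zmul s t) (zmul s u).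
Proof.
move=> tu; elim: s => [|x s IHs]; first exact: tensor_refl.
by rewrite !(zmul_cons x s); apply: tensor_cat => //; exact: zmul1_eq.
Qed.

Lemma zmuls1 s y : zmul s [:: y] = [seq (x.1 * y.1, x.2 * y.2) | x <- s].
Proof. by elim: s => //= x s IHs; rewrite zmul_cons IHs. Qed.

Lemma zmul_s1_eq y s t : teq s t -> teq (zmul s [:: y]) (zmul t [:: y]).
Proof.
case: y => c b; elim=> [{}s|{}s {}t _ +|{}t {}s u _ + _ +|{}s s' {}t t' _ + _ +
  |{}s {}t|m|a a' m|a m m'|a r m]; rewrite ?zmul_catl ?zmuls1 /=.
- exact: tensor_refl.
- exact: tensor_sym.
- exact: tensor_trans.
- exact: tensor_cat.
- exact: tensor_catC.
- by rewrite mul0r; exact: tensor_0l.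
- by rewrite mulrDl; exact: tensor_Dl.
- by rewrite mulrDl; exact: tensor_Dr.
- by rewrite mulrAC -palg_scalerAl; exact: tensor_Z.
Qed.

Lemma zmuls0 s : zmul s [::] = [::].
Proof. by elim: s => // x s IHs; rewrite zmul_cons IHs. Qed.

Lemma zmull_eq s t u : teq s t -> teq (zmul s u) (zmul t u).
Proof.
move=> st; elim: u => [|y u IHu]; first by rewrite !zmuls0; exact: tensor_refl.
rewrite -cat1s; apply: tensor_trans (zmul_catr _ _ _) _.
apply: tensor_trans (tensor_sym (zmul_catr _ _ _)).
by apply: tensor_cat => //; exact: zmul_s1_eq.
Qed.

Definition tmul : T -> T -> T :=
  locked (fun u v => tpi phi (zmul (repr u) (repr v))).
Definition tone : T := pure phi 1 (1 : B).

Lemma tpi_mul s t : tmul (tpi phi s) (tpi phi t) = tpi phi (zmul s t).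
Proof.
rewrite /tmul -lock; apply/tpiP.
apply: (tensor_trans (t := zmul s (repr (tpi phi t)))).
  by apply: zmull_eq; apply/tpiP; exact: tpi_repr.
by apply: zmulr_eq; apply/tpiP; exact: tpi_repr.
Qed.

Lemma zmul_pureA x y u : zmul [:: x] (zmul [:: y] u) = zmul (zmul [:: x] [:: y]) u.
Proof.
have -> : zmul [:: x] [:: y] = [:: (x.1 * y.1, x.2 * y.2)] by [].
rewrite (zmul1s (x.1 * y.1, x.2 * y.2)) (zmul1s y) (zmul1s x) -map_comp.
by apply: eq_map => z; congr pair; exact: mulrA.
Qed.

Lemma zmul1A x t u : zmul [:: x] (zmul t u) = zmul (zmul [:: x] t) u.
Proof.
elim: t => [|y t IHt]; first by rewrite !zmul1s.
rewrite (zmul_cons y t) zmul1_cat IHt zmul_pureA -zmul_catl.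
by rewrite -zmul1_cat.
Qed.

Lemma zmulA : associative zmul.
Proof.
elim=> [|x s IHs] t u //.
by rewrite (zmul_cons x s) zmul1A IHs -zmul_catl -zmul_cons.
Qed.

Lemma tmulA : associative tmul.
Proof.
by elim/tensorW=> s; elim/tensorW=> t; elim/tensorW=> u; rewrite !tpi_mul zmulA.
Qed.
Lemma tmul1 : left_id tone tmul.
Proof.
elim/tensorW=> s; rewrite /tone /pure tpi_mul; congr tpi; rewrite zmul1s.
by rewrite -[RHS]map_id; apply: eq_map => -[a m]; rewrite /= !mul1r.
Qed.
Lemma tmulr1 : right_id tone tmul.
Proof.
elim/tensorW=> s; rewrite /tone /pure tpi_mul; congr tpi; rewrite zmuls1.
by rewrite -[RHS]map_id; apply: eq_map => -[a m]; rewrite /= !mulr1.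
Qed.
Lemma tmulDl : left_distributive tmul +%R.
Proof.
elim/tensorW=> s; elim/tensorW=> t; elim/tensorW=> u.
by rewrite -tpiD !tpi_mul zmul_catl tpiD.
Qed.
Lemma tmulDr : right_distributive tmul +%R.
Proof.
elim/tensorW=> s; elim/tensorW=> t; elim/tensorW=> u.
by rewrite -tpiD !tpi_mul -tpiD; apply/tpiP; exact: zmul_catr.
Qed.

HB.instance Definition _ := GRing.Zmodule_isPzRing.Build T
  tmulA tmul1 tmulr1 tmulDl tmulDr.

Lemma tpure_mul a b x y :
  (pure phi a x : T) * pure phi b y = pure phi (a * b) (x * y : B).
Proof. exact: tpi_mul. Qed.

Lemma zscale_zmul a s t : zscale a (zmul s t) = zmul (zscale a s) t.
Proof.
elim: s => // x s IHs.
rewrite [LHS]map_cat -map_comp -[zscale a (x :: s)]cat1s zmul_catl -IHs zmul1s.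
by congr cat; apply: eq_map => y; congr pair; exact: mulrA.
Qed.

Lemma tensor_scalerAl a (u w : T) : a *: (u * w) = (a *: u) * w.
Proof.
elim/tensorW: u => s; elim/tensorW: w => t; rewrite /GRing.scale /GRing.mul /=.
by rewrite tpi_mul !tpi_scale tpi_mul zscale_zmul.
Qed.

Lemma tensor_scalerAr a (u w : T) : a *: (u * w) = u * (a *: w).
Proof.
elim/tensorW: u => s; elim/tensorW: w => t; rewrite /GRing.scale /GRing.mul /=.
rewrite tpi_mul !tpi_scale tpi_mul; congr tpi.
elim: s => // x s IHs.
rewrite [LHS]map_cat (zmul_cons x s) -IHs zmul1s -!map_comp.
by congr cat; apply: eq_map => y; congr pair; exact: mulrCA.
Qed.
End TensorAlgebra.


Section QuantumNumbers.
Variables (F : fieldType) (q : F).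

Definition qint (a : int) : F := (q ^ a - q ^ (- a)) / (q - q^-1).

Definition qfact (t : nat) : F := \prod_(1 <= s < t.+1) qint s%:Z.

Definition qbin (a : int) (t : nat) : F :=
  (\prod_(0 <= s < t) (q ^ (a - s%:Z) - q ^ (- a + s%:Z))) /
  (\prod_(1 <= s < t.+1) (q ^ s%:Z - q ^ (- s%:Z))).

Lemma qbin_pascal (a : int) (t : nat) : q != 0 ->
  (forall s : nat, (0 < s)%N -> q ^ s%:Z - q ^ (- s%:Z) != 0) ->
  qbin (a + 1) t.+1 = q ^ t.+1%:Z * qbin a t.+1 + q ^ (t%:Z - a) * qbin a t.
Proof.
move=> q0 qs; rewrite /qbin.
rewrite big_nat_recl // [\prod_(0 <= s < t.+1) _]big_nat_recr //.
rewrite [\prod_(1 <= s < t.+2) _]big_nat_recr // [LHS]/= [RHS]/=.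
set D := \prod_(1 <= s < t.+1) _.
have D0 : D != 0.
  rewrite prodf_seq_neq0; apply/allP => s; rewrite mem_index_iota => /andP[s0 _].
  by rewrite qs.
have -> : \prod_(0 <= i < t) (q ^ (a + 1 - i.+1%:Z) - q ^ (- (a + 1) + i.+1%:Z))
        = \prod_(0 <= i < t) (q ^ (a - i%:Z) - q ^ (- a + i%:Z)).
  by apply: eq_bigr => i _; congr (q ^ _ - q ^ _); rewrite -addn1 PoszD; ring.
set N := \prod_(0 <= i < t) _.
have e1 := qs _ (ltn0Sn t).
have E : q ^ (a + 1 - 0%:Z) - q ^ (- (a + 1) + 0%:Z)
  = q ^ t.+1%:Z * (q ^ (a - t%:Z) - q ^ (- a + t%:Z))
    + q ^ (t%:Z - a) * (q ^ t.+1%:Z - q ^ (- t.+1%:Z)).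
  rewrite !mulrBr -!(expfzDr _ _ q0).
  have -> : a + 1 - 0%:Z = t.+1%:Z + (a - t%:Z) by rewrite -addn1 PoszD; ring.
  have -> : - (a + 1) + 0%:Z = t%:Z - a - t.+1%:Z by rewrite -addn1 PoszD; ring.
  have -> : t%:Z - a + t.+1%:Z = t.+1%:Z + (- a + t%:Z) by ring.
  by ring.
rewrite E; field.
by rewrite D0 e1.
Qed.

Lemma qdiff_neq0 (s : nat) :
  q != 0 -> q ^+ (s + s) != 1 -> q ^ s%:Z - q ^ (- s%:Z) != 0.
Proof.
move=> q0; apply: contraNneq => /eqP; rewrite subr_eq0 => /eqP E.
by rewrite exprD exprnP {1}E -exprnN -exprnP mulVf // expf_neq0.
Qed.
End QuantumNumbers.

Definition Qv : Type := {fraction {poly rat}}.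
HB.instance Definition _ := GRing.Field.on Qv.

Definition v : Qv := tofrac 'X.

Definition laurent : {pred Qv} := fun x =>
  `[< exists (p : {poly int}) (m : nat), x = (map_poly intr p).[v] / v ^+ m >].

Lemma laurentP x : reflect
  (exists (p : {poly int}) (m : nat), x = (map_poly intr p).[v] / v ^+ m)
  (x \in laurent).
Proof. exact: asboolP. Qed.

Lemma v_neq0 : v != 0.
Proof. by rewrite tofrac_eq0 polyX_eq0. Qed.

Lemma v_expn_neq1 m : (0 < m)%N -> v ^+ m != 1.
Proof.
move=> m0; rewrite /v -tofracXn -tofrac1 tofrac_eq.
apply/eqP => /(congr1 (fun p : {poly rat} => size p)).
rewrite size_polyXn size_poly1 => -[m1].
by rewrite m1 in m0.
Qed.

Lemma laurent_subring : subring_closed laurent.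
Proof.
have vn m : v ^+ m != 0 by rewrite expf_neq0 // v_neq0.
split=> [|x y /laurentP[p [m ->]] /laurentP[r [k ->]]|
         x y /laurentP[p [m ->]] /laurentP[r [k ->]]]; apply/laurentP.
- by exists 1, 0; rewrite rmorph1 hornerC expr0 divr1.
- exists (p * 'X^k - r * 'X^m), (m + k)%N.
  rewrite rmorphB !rmorphM /= !map_polyXn hornerD hornerN !hornerM !hornerXn exprD.
  rewrite mulrBl; congr (_ - _).
    by rewrite invfM mulrACA divff ?mulr1.
  by rewrite invfM [_^-1 * _]mulrC mulrACA divff ?mulr1.
- exists (p * r), (m + k)%N.
  by rewrite rmorphM hornerM exprD invfM mulrACA.
Qed.
HB.instance Definition _ := GRing.isSubringClosed.Build Qv laurent laurent_subring.

Record zlaurent := ZLaurent { zl_val : Qv; _ : zl_val \in laurent }.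
HB.instance Definition _ := [isSub for zl_val].
HB.instance Definition _ := [Choice of zlaurent by <:].
HB.instance Definition _ := [SubChoice_isSubComNzRing of zlaurent by <:].

Lemma zl_val_is_zmod_morphism : zmod_morphism zl_val.
Proof. by move=> x y; exact: (rmorphB (\val : {rmorphism zlaurent -> Qv})). Qed.
HB.instance Definition _ :=
  GRing.isZmodMorphism.Build zlaurent Qv zl_val zl_val_is_zmod_morphism.

Lemma zl_val_is_monoid_morphism : monoid_morphism zl_val.
Proof.
split; first exact: (rmorph1 (\val : {rmorphism zlaurent -> Qv})).
exact: (rmorphM (\val : {rmorphism zlaurent -> Qv})).
Qed.
HB.instance Definition _ :=
  GRing.isMonoidMorphism.Build zlaurent Qv zl_val zl_val_is_monoid_morphism.

Lemma v_laurent : v \in laurent.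
Proof. by apply/laurentP; exists 'X, 0; rewrite map_polyX hornerX expr0 divr1. Qed.

Lemma vV_laurent : v^-1 \in laurent.
Proof. by apply/laurentP; exists 1, 1; rewrite rmorph1 hornerC expr1 mul1r. Qed.

Lemma vz_laurent d (a : int) : (v ^+ d) ^ a \in laurent.
Proof.
case: a => n; first by rewrite -exprnP !rpredX // v_laurent.
by rewrite NegzE -exprnN -exprVn -exprVn !rpredX // vV_laurent.
Qed.

Lemma qbin_laurent d (a : int) (t : nat) : qbin (v ^+ d) a t \in laurent.
Proof.
have q0 : v ^+ d != 0 by rewrite expf_neq0 // v_neq0.
have qL m : (v ^+ d) ^ m \in laurent by exact: vz_laurent.
case: d q0 qL => [|d] q0 qL.
  case: t => [|t]; first by rewrite /qbin !big_geq // divr1 rpred1.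
  by rewrite /qbin big_nat_recl //= expr0 !exp1rz subrr mul0r mul0r rpred0.
have qs (s : nat) : (0 < s)%N -> (v ^+ d.+1) ^ s%:Z - (v ^+ d.+1) ^ (- s%:Z) != 0.
  move=> s0; apply: qdiff_neq0 q0 _; rewrite -exprM; apply: v_expn_neq1.
  by rewrite muln_gt0 addn_gt0 s0.
elim: t a => [|t IHt] a; first by rewrite /qbin !big_geq // divr1 rpred1.
have q00 : qbin (v ^+ d.+1) 0 t.+1 = 0.
  rewrite /qbin big_nat_recl // (_ : - 0 + 0%:Z = 0 - 0%:Z :> int) //.
  by rewrite subrr !mul0r.
elim/int_ind: a => [|n IHn|n IHn].
- by rewrite q00 rpred0.
- rewrite -[n.+1]addn1 PoszD (qbin_pascal _ _ q0 qs).
  by rewrite rpredD // rpredM.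
- have := qbin_pascal (- n.+1%:Z) t q0 qs.
  have -> : - n.+1%:Z + 1 = - n%:Z by rewrite -[n.+1]addn1 PoszD opprD addrNK.
  move=> E; have -> : qbin (v ^+ d.+1) (- n.+1%:Z) t.+1
     = (v ^+ d.+1) ^ (- t.+1%:Z) * (qbin (v ^+ d.+1) (- n%:Z) t.+1
        - (v ^+ d.+1) ^ (t%:Z - - n.+1%:Z) * qbin (v ^+ d.+1) (- n.+1%:Z) t).
    by rewrite E addrK mulrA -expfzDr // addNr expr0z mul1r.
  by rewrite rpredM // rpredB // rpredM.
Qed.

Definition zqbin (d : nat) (a : int) (t : nat) : zlaurent :=
  ZLaurent (qbin_laurent d a t).


(* A weight is identified with its coordinates l 0 i = <alpha_i^vee, l>: the
   simple coroots are a basis of the Cartan subalgebra, so X is Z^n.           *)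
Notation weight n := 'rV[int]_n.

Section RootData.
Variables (n : nat) (C : 'M[int]_n) (d : 'I_n -> nat).

Definition finite_cartan : Prop :=
  [/\ forall i, C i i = 2,
      forall i j, i != j -> C i j <= 0,
      forall i, d i \in [:: 1; 2; 3]%N,
      forall i j, (d i)%:Z * C i j = (d j)%:Z * C j i
    & forall x : 'rV[rat]_n, x != 0 ->
        0 < \sum_i \sum_j x 0 i * ((d i)%:Z * C i j)%:~R * x 0 j].

Definition pairing (i : 'I_n) (l : weight n) : int := l 0 i.

Definition simple_root (j : 'I_n) : weight n := \row_i C i j.

Definition dominant (l : weight n) : Prop := forall i, 0 <= pairing i l.

Definition le_weight (l m : weight n) : Prop :=
  exists c : 'I_n -> nat, m - l = \sum_i simple_root i *+ c i.

Definition reflection (i : 'I_n) (l : weight n) : weight n :=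
  l - simple_root i *~ pairing i l.

(* The reflections are involutions, so their products form the group W. *)
Inductive weyl : (weight n -> weight n) -> Prop :=
| weyl_id : weyl id
| weyl_reflection i w : weyl w -> weyl (reflection i \o w).

Definition saturated (pi : set (weight n)) : Prop :=
  forall l m, pi m -> dominant l -> le_weight l m -> pi l.

Definition weyl_orbits (pi : set (weight n)) : set (weight n) :=
  [set l | exists w m, [/\ weyl w, pi m & l = w m]].

Definition serre_exp (i j : 'I_n) : nat := `|1 - C i j|%N.
End RootData.


Section SAlgebra.
Variables (n : nat) (C : 'M[int]_n) (d : 'I_n -> nat) (pi : set (weight n)).
Local Notation Wpi := (weyl_orbits C pi).
Local Notation alpha := (simple_root C).

Definition S_gen : Type := ('I_n + 'I_n + {l : weight n | l \in Wpi})%type.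
HB.instance Definition _ := Choice.on S_gen.

Local Notation Fr := (free_alg Qv S_gen).

Definition S_e (i : 'I_n) : Fr := fgen Qv (inl (inl i) : S_gen).
Definition S_f (i : 'I_n) : Fr := fgen Qv (inl (inr i) : S_gen).
Definition S_o (l : weight n) : Fr :=
  if insub l is Some l' then fgen Qv (inr l' : S_gen) else 0.

Local Notation E := S_e.
Local Notation F := S_f.
Local Notation "'1_' l" := (S_o l) (at level 2, l at level 1).

(* Wpi is finite when pi is, hence the finitely supported sums below are the
   full sums over Wpi.                                                        *)
Inductive S_rel : Fr -> Fr -> Prop :=
| S_idem l m : l \in Wpi -> m \in Wpi ->
    S_rel (1_l * 1_m) (if l == m then 1_l else 0)
| S_unit : S_rel (\sum_(l \in Wpi) 1_l) 1
| S_EF i j : S_rel (E i * F j - F j * E i)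
    (if i == j then \sum_(l \in Wpi) qint (v ^+ d i) (pairing i l) *: 1_l else 0)
| S_E1 i l : l \in Wpi -> S_rel (E i * 1_l)
    (if l + alpha i \in Wpi then 1_(l + alpha i) * E i else 0)
| S_F1 i l : l \in Wpi -> S_rel (F i * 1_l)
    (if l - alpha i \in Wpi then 1_(l - alpha i) * F i else 0)
| S_1E i l : l \in Wpi -> S_rel (1_l * E i)
    (if l - alpha i \in Wpi then E i * 1_(l - alpha i) else 0)
| S_1F i l : l \in Wpi -> S_rel (1_l * F i)
    (if l + alpha i \in Wpi then F i * 1_(l + alpha i) else 0)
| S_serreE i j : i != j -> let m := serre_exp C i j in
    S_rel (\sum_(0 <= s < m.+1) ((-1) ^+ s * qbin (v ^+ d i) m%:Z s) *:
             (E i ^+ (m - s) * E j * E i ^+ s)) 0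
| S_serreF i j : i != j -> let m := serre_exp C i j in
    S_rel (\sum_(0 <= s < m.+1) ((-1) ^+ s * qbin (v ^+ d i) m%:Z s) *:
             (F i ^+ (m - s) * F j * F i ^+ s)) 0.

Definition S_alg : Type := palg S_rel.
HB.instance Definition _ := GRing.PzRing.on S_alg.
HB.instance Definition _ := GRing.Lmodule.on S_alg.

Definition S_E (i : 'I_n) : S_alg := ppi S_rel (S_e i).
Definition S_F (i : 'I_n) : S_alg := ppi S_rel (S_f i).
Definition S_1 (l : weight n) : S_alg := ppi S_rel (S_o l).

Inductive AS : set S_alg :=
| AS_1 l : l \in Wpi -> AS (S_1 l)
| AS_E i (m : nat) : AS ((qfact (v ^+ d i) m)^-1 *: S_E i ^+ m)
| AS_F i (m : nat) : AS ((qfact (v ^+ d i) m)^-1 *: S_F i ^+ m)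
| AS_one : AS 1
| AS_add x y : AS x -> AS y -> AS (x + y)
| AS_mul x y : AS x -> AS y -> AS (x * y)
| AS_scale (a : zlaurent) x : AS x -> AS (zl_val a *: x).
End SAlgebra.


Section TAlgebra.
Variables (n : nat) (C : 'M[int]_n) (d : 'I_n -> nat) (pi : set (weight n)).
Local Notation Wpi := (weyl_orbits C pi).
Local Notation alpha := (simple_root C).

Definition T_gen : Type :=
  ('I_n * nat + 'I_n * nat + {l : weight n | l \in Wpi})%type.
HB.instance Definition _ := Choice.on T_gen.

Local Notation Fr := (free_alg zlaurent T_gen).

Definition T_e (i : 'I_n) (a : nat) : Fr := fgen zlaurent (inl (inl (i, a)) : T_gen).
Definition T_f (i : 'I_n) (b : nat) : Fr := fgen zlaurent (inl (inr (i, b)) : T_gen).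
Definition T_o (l : weight n) : Fr :=
  if insub l is Some l' then fgen zlaurent (inr l' : T_gen) else 0.

Local Notation E := T_e.
Local Notation F := T_f.
Local Notation "'1_' l" := (T_o l) (at level 2, l at level 1).

(* In T_E1F and T_F1E the weight l ranges over all of X, with the convention
   1_l = 0 off Wpi, and the terms with t > min(a, b) vanish since divided
   powers of negative exponent are zero.                                      *)
Inductive T_rel : Fr -> Fr -> Prop :=
| T_idem l m : l \in Wpi -> m \in Wpi ->
    T_rel (1_l * 1_m) (if l == m then 1_l else 0)
| T_unit : T_rel (\sum_(l \in Wpi) 1_l) 1
| T_EE i a b : T_rel (E i a * E i b) (zqbin (d i) (a + b)%:Z a *: E i (a + b))
| T_FF i a b : T_rel (F i a * F i b) (zqbin (d i) (a + b)%:Z a *: F i (a + b))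
| T_E0 i : T_rel (E i 0) 1
| T_F0 i : T_rel (F i 0) 1
| T_EF i j a b : i != j -> T_rel (E i a * F j b) (F j b * E i a)
| T_E1F i a b l : T_rel (E i a * 1_(- l) * F i b)
    (\sum_(0 <= t < (minn a b).+1)
       zqbin (d i) ((a + b)%:Z - pairing i l) t *:
         (F i (b - t) * 1_(- l + alpha i *+ (a + b - t)) * E i (a - t)))
| T_F1E i a b l : T_rel (F i b * 1_l * E i a)
    (\sum_(0 <= t < (minn a b).+1)
       zqbin (d i) ((a + b)%:Z - pairing i l) t *:
         (E i (a - t) * 1_(l - alpha i *+ (a + b - t)) * F i (b - t)))
| T_E1 i a l : l \in Wpi -> T_rel (E i a * 1_l)
    (if l + alpha i *+ a \in Wpi then 1_(l + alpha i *+ a) * E i a else 0)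
| T_F1 i b l : l \in Wpi -> T_rel (F i b * 1_l)
    (if l - alpha i *+ b \in Wpi then 1_(l - alpha i *+ b) * F i b else 0)
| T_1E i a l : l \in Wpi -> T_rel (1_l * E i a)
    (if l - alpha i *+ a \in Wpi then E i a * 1_(l - alpha i *+ a) else 0)
| T_1F i b l : l \in Wpi -> T_rel (1_l * F i b)
    (if l + alpha i *+ b \in Wpi then F i b * 1_(l + alpha i *+ b) else 0)
| T_serreE i j : i != j -> let m := serre_exp C i j in
    T_rel (\sum_(0 <= s < m.+1) (-1) ^+ s * E i (m - s) * E j 1 * E i s) 0
| T_serreF i j : i != j -> let m := serre_exp C i j in
    T_rel (\sum_(0 <= s < m.+1) (-1) ^+ s * F i (m - s) * F j 1 * F i s) 0.

Definition AT_alg : Type := palg T_rel.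
HB.instance Definition _ := GRing.PzRing.on AT_alg.
HB.instance Definition _ := GRing.Lmodule.on AT_alg.

Definition T_alg : Type := tensor zl_val (palg T_rel).
HB.instance Definition _ := GRing.PzRing.on T_alg.
HB.instance Definition _ := GRing.Lmodule.on T_alg.

Definition T_incl (x : AT_alg) : T_alg := pure zl_val 1 x.

Definition T_E (i : 'I_n) : T_alg := T_incl (ppi T_rel (T_e i 1)).
Definition T_F (i : 'I_n) : T_alg := T_incl (ppi T_rel (T_f i 1)).
Definition T_1 (l : weight n) : T_alg := T_incl (ppi T_rel (T_o l)).
End TAlgebra.

Inductive zspan (V : lmodType Qv) (P : set V) : set V :=
| zspan0 : zspan P 0
| zspan_gen x : P x -> zspan P x
| zspan_add x y : zspan P x -> zspan P y -> zspan P (x + y)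
| zspan_scale (a : zlaurent) x : zspan P x -> zspan P (zl_val a *: x).

(* Main.v *)
From HB Require Import structures.
Require Import Defs.
From mathcomp Require Import all_boot all_order all_algebra.
From mathcomp Require Import boolp classical_sets functions cardinality.
From mathcomp Require Import fsbigop finmap monalg ring.

Set Implicit Arguments.
Unset Strict Implicit.
Unset Printing Implicit Defensive.

Import GRing.Theory.
Local Open Scope classical_set_scope.
Local Open Scope ring_scope.

(** Both algebras are presented by generators and relations, and each satisfies
    the relations of the other once [E_i^(a)] is read as the divided power
    [E_i^a / [a]!].  This gives a [Q(v)]-algebra map from [S] to [T] and a map
    from the integral algebra to [S] that is semilinear over [Z[v, 1/v]] and so
    extends to [T].  The two composites fix the generators: over [Q(v)] the
    relations [E_i^(a) E_i^(b) = [a+b choose a] E_i^(a+b)] and [E_i^(0) = 1] force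
    [E_i^(m) = E_i^m / [m]!].  The second map sends the integral generators
    exactly to the generators of the integral form of [S], so the isomorphism
    matches the two integral forms.

    Everything rests on one convention: with [1_l = 0] off the orbit set, the
    four families of weight relations collapse to [E_i 1_l = 1_(l + alpha_i) E_i]
    and [F_i 1_l = 1_(l - alpha_i) F_i] for every weight [l].  On a line
    [l + Z alpha_i] the relations of [S] then read as those of a rank one
    algebra: [(ef - fe) o_k = [c + 2k] o_k], [e o_k = o_(k+1) e],
    [f o_k = o_(k-1) f].  There the commutation formula for
    [e^(a) o_0 f^(b)] is proved by induction on [a]
    ([dpow_commutation], [dpow_sandwich]); the induction step is an identity
    between products of two quantum integers ([qint_mulE]).  Exchanging [e] and
    [f] gives the formula for [f^(b) o_0 e^(a)].  Conversely the case
    [a = b = 1] of that formula, summed over all weights, gives back the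
    expression for [E_i F_i - F_i E_i] ([T_1_EF], [T_EF_sum]).  The Serre
    relations differ by the factor [[m]!] ([divided_serre]).

    Sums over all orbit weights occur in the relation [sum_l 1_l = 1] and in the
    one for [E_i F_i - F_i E_i].  If the orbit set is finite they are honest finite
    sums; if it were infinite, the finitely supported sum [sum_l 1_l] would be 0,
    so that [1 = 0] and every relation would hold trivially ([S_infinite],
    [T_infinite]).  This dichotomy takes the place of the finiteness of the Weyl
    group. *)

(** * Algebras by generators and relations *)

Section ScalarMorphisms.
Variables (R K : comNzRingType) (phi : {rmorphism R -> K}).
Variables (G : choiceType) (relK : free_alg K G -> free_alg K G -> Prop).
Variables (relR : free_alg R G -> free_alg R G -> Prop).

(** Since the algebra may be zero, scalars enter through a ring morphism with
    central image; this is the form in which the universal property takes them. *)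
Definition palg_scalar (c : K) : palg relK := c *: (1 : palg relK).

Lemma palg_scalarE c u : palg_scalar c * u = c *: u.
Proof. by rewrite -palg_scalerAl mul1r. Qed.

Lemma palg_scalar_central c u : palg_scalar c * u = u * palg_scalar c.
Proof. by rewrite palg_scalarE -palg_scalerAr mulr1. Qed.

Lemma palg_scalar_is_zmod_morphism : zmod_morphism palg_scalar.
Proof. by move=> a b; rewrite /palg_scalar scalerBl. Qed.
HB.instance Definition _ :=
  GRing.isZmodMorphism.Build K (palg relK)
    palg_scalar palg_scalar_is_zmod_morphism.

Lemma palg_scalar_is_monoid_morphism : monoid_morphism palg_scalar.
Proof. by split=> [|a b]; rewrite ?palg_scalarE /palg_scalar ?scale1r ?scalerA. Qed.
HB.instance Definition _ := GRing.isMonoidMorphism.Build K (palg relK)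
  palg_scalar palg_scalar_is_monoid_morphism.

Local Notation T := (tensor phi (palg relR)).

Definition tensor_scalar (c : K) : T := c *: (1 : T).

Lemma tensor_scalarE c u : tensor_scalar c * u = c *: u.
Proof. by rewrite -tensor_scalerAl mul1r. Qed.

Lemma tensor_scalar_central c u : tensor_scalar c * u = u * tensor_scalar c.
Proof. by rewrite tensor_scalarE -tensor_scalerAr mulr1. Qed.

Lemma tensor_scalar_is_zmod_morphism : zmod_morphism tensor_scalar.
Proof. by move=> a b; rewrite /tensor_scalar scalerBl. Qed.
HB.instance Definition _ :=
  GRing.isZmodMorphism.Build K T tensor_scalar tensor_scalar_is_zmod_morphism.

Lemma tensor_scalar_is_monoid_morphism : monoid_morphism tensor_scalar.
Proof. by split=> [|a b]; rewrite ?tensor_scalarE /tensor_scalar ?scale1r ?scalerA. Qed.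
HB.instance Definition _ := GRing.isMonoidMorphism.Build K T
  tensor_scalar tensor_scalar_is_monoid_morphism.
End ScalarMorphisms.

Section FreeLift.
Variables (R : comNzRingType) (A : pzRingType) (phi : {rmorphism R -> A}).
Hypothesis phi_central : forall c x, phi c * x = x * phi c.
Variables (G : choiceType) (h : G -> A).
Local Notation F := (free_alg R G).

Definition monom_value (k : {fmonom G}) : A := \prod_(g <- (k : seq G)) h g.

(** The universal property of the free algebra, with coefficients transported
    along a ring morphism [phi], so that one construction serves both the
    [Q(v)]-algebra [S] and the [Z[v, 1/v]]-algebra mapped into [S]. *)
Definition free_lift (x : F) : A :=
  \sum_(k <- msupp x) phi x@_k * monom_value k.

Lemma free_liftEw (D : {fset {fmonom G}}) (x : F) : (msupp x `<=` D)%fset ->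
  free_lift x = \sum_(k <- D) phi x@_k * monom_value k.
Proof.
move=> le; rewrite /free_lift (big_fset_incl _ le) => //= k _ /mcoeff_outdom ->.
by rewrite rmorph0 mul0r.
Qed.

Lemma free_liftU c k : free_lift << c *g k >> = phi c * monom_value k.
Proof. by rewrite (free_liftEw msuppU_le) big_seq_fset1 mcoeffUU. Qed.

Lemma free_lift_is_zmod_morphism : zmod_morphism free_lift.
Proof.
move=> x y; have xD := fsubsetUl (msupp x) (msupp y).
have yD := fsubsetUr (msupp x) (msupp y).
rewrite (free_liftEw (msuppB_le _ _)) (free_liftEw xD) (free_liftEw yD) -sumrB.
by apply: eq_bigr => k _; rewrite mcoeffB rmorphB mulrBl.
Qed.
HB.instance Definition _ :=
  GRing.isZmodMorphism.Build F A free_lift free_lift_is_zmod_morphism.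

Lemma monom_valueM k l : monom_value (mmul k l) = monom_value k * monom_value l.
Proof. by rewrite /monom_value fmM big_cat. Qed.

Lemma free_lift_is_monoid_morphism : monoid_morphism free_lift.
Proof.
split; first by rewrite free_liftU rmorph1 mul1r /monom_value fm1 big_nil.
move=> x y; rewrite malgME raddf_sum mulr_suml; apply: eq_bigr => k _.
rewrite raddf_sum mulr_sumr; apply: eq_bigr => l _.
rewrite [LHS]free_liftU rmorphM monom_valueM -!mulrA; congr (_ * _).
by rewrite !mulrA phi_central.
Qed.
HB.instance Definition _ :=
  GRing.isMonoidMorphism.Build F A free_lift free_lift_is_monoid_morphism.

Lemma free_liftZ c (x : F) : free_lift (c *: x) = phi c * free_lift x.
Proof.
rewrite (free_liftEw (msuppZ_le _ _)) mulr_sumr; apply: eq_bigr => k _.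
by rewrite mcoeffZ rmorphM mulrA.
Qed.

Lemma free_lift_gen g : free_lift (fgen R g) = h g.
Proof. by rewrite free_liftU rmorph1 mul1r /monom_value fmU big_seq1. Qed.

Variable rel : F -> F -> Prop.
Hypothesis lift_rel : forall x y, rel x y -> free_lift x = free_lift y.

Definition palg_lift (u : palg rel) : A := free_lift (repr u).

Lemma palg_lift_pi x : palg_lift (ppi rel x) = free_lift x.
Proof.
apply/eqP; rewrite -subr_eq0 -raddfB; apply/eqP.
have /ppiP : ppi rel (repr (ppi rel x)) = ppi rel x by exact: ppi_repr.
rewrite -[X in X = 0]/(free_lift _).
elim=> [|a y z b /lift_rel yz|y z _ y0 _ z0|y _ y0].
- exact: raddf0.
- by rewrite !rmorphM rmorphB /= yz subrr mulr0 mul0r.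
- by rewrite rmorphD /= y0 z0 addr0.
- by rewrite rmorphN /= y0 oppr0.
Qed.

Lemma palg_lift_is_zmod_morphism : zmod_morphism palg_lift.
Proof.
elim/palgW=> x; elim/palgW=> y.
by rewrite -ppiB !palg_lift_pi rmorphB.
Qed.
HB.instance Definition _ :=
  GRing.isZmodMorphism.Build (palg rel) A palg_lift palg_lift_is_zmod_morphism.

Lemma palg_lift_is_monoid_morphism : monoid_morphism palg_lift.
Proof.
split; first by rewrite -[1]/(ppi rel 1) palg_lift_pi rmorph1.
elim/palgW=> x; elim/palgW=> y.
by rewrite -rmorphM !palg_lift_pi rmorphM.
Qed.
HB.instance Definition _ := GRing.isMonoidMorphism.Build (palg rel) A
  palg_lift palg_lift_is_monoid_morphism.

Lemma palg_liftZ c u : palg_lift (c *: u) = phi c * palg_lift u.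
Proof. by elim/palgW: u => x; rewrite -linearZ !palg_lift_pi free_liftZ. Qed.

End FreeLift.

(** Two algebra morphisms that agree on the generators agree: such statements
    are proved by this induction. *)
Lemma palg_gen_ind (R : comNzRingType) (G : choiceType) rel
    (P : @palg R G rel -> Prop) :
  (forall g, P (ppi rel (fgen R g))) -> P 1 ->
  (forall u w, P u -> P w -> P (u + w)) ->
  (forall u w, P u -> P w -> P (u * w)) ->
  (forall c u, P u -> P (c *: u)) -> forall u, P u.
Proof.
move=> Pgen P1 PD PM PZ; elim/palgW=> x; rewrite [x]monalgE raddf_sum /=.
elim/big_ind: _ => [|//|k _]; first by rewrite -(scale0r (1 : palg rel)); exact: PZ.
have -> : << x@_k *g k >> = x@_k *: \prod_(g <- (k : seq G)) fgen R g.
  have -> : \prod_(g <- (k : seq G)) fgen R g = << k >>.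
    case: k => s /=; elim: s => [|g s IHs]; first by rewrite big_nil -fmoneE.
    by rewrite big_cons IHs malgM_def fgmulUU mulr1 fmuE /mmul /= fmmulE.
  by apply/malgP => l; rewrite mcoeffZ !mcoeffU mulr_natr.
rewrite linearZ /=; apply: PZ; rewrite rmorph_prod.
by elim/big_ind: _ => [||g _]; [exact: P1 | exact: PM | exact: Pgen].
Qed.

Lemma raddf_fsum (U V : zmodType) (f : {additive U -> V}) (I : choiceType)
    (D : set I) (F : I -> U) : finite_set D ->
  f (\sum_(i \in D) F i) = \sum_(i \in D) f (F i).
Proof. by move=> finD; rewrite !fsbig_finite // raddf_sum. Qed.

Section Images.
Variables (R : comNzRingType) (G : choiceType).
Variable rel : free_alg R G -> free_alg R G -> Prop.

Lemma ppiZ c x : ppi rel (c *: x) = c *: ppi rel x.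
Proof. exact: linearZ. Qed.

Lemma ppi_serre (c : nat -> R) x y m :
  ppi rel (\sum_(0 <= s < m.+1) c s *: (x ^+ (m - s) * y * x ^+ s)) =
  \sum_(0 <= s < m.+1) c s *: (ppi rel x ^+ (m - s) * ppi rel y * ppi rel x ^+ s).
Proof.
rewrite raddf_sum; apply: eq_bigr => s _.
by rewrite [LHS]ppiZ !rmorphM !rmorphXn.
Qed.

Lemma ppi_mul3 x y z : ppi rel (x * y * z) = ppi rel x * ppi rel y * ppi rel z.
Proof. by rewrite !rmorphM. Qed.

Lemma ppi_scale_mul3 c x y z :
  ppi rel (c *: (x * y * z)) = c *: (ppi rel x * ppi rel y * ppi rel z).
Proof. by rewrite [LHS]ppiZ [X in _ *: X]ppi_mul3. Qed.
End Images.

(** A combination of orthogonal idempotents is diagonal: it acts on each of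
    them through its own coefficient. *)
Lemma ppi_orthogonal_sum (R : comNzRingType) (G I : choiceType)
    (rel : free_alg R G -> free_alg R G -> Prop) (D : set I) (c : I -> R)
    (o : I -> free_alg R G) i :
  finite_set D -> i \in D ->
  (forall j, j \in D ->
    ppi rel (o j) * ppi rel (o i) = if j == i then ppi rel (o j) else 0) ->
  ppi rel (\sum_(j \in D) c j *: o j) * ppi rel (o i) = c i *: ppi rel (o i).
Proof.
move=> finD iD oo; rewrite raddf_fsum // fsbig_finite // mulr_suml.
have iDs : i \in (fset_set D : seq I) by rewrite in_fset_set.
rewrite (bigD1_seq i) ?fset_uniq //= [X in X * _]ppiZ -palg_scalerAl oo // eqxx.
rewrite big1_seq ?addr0 // => j /andP[/negPf ji jDs].
by rewrite [X in X * _]ppiZ -palg_scalerAl oo ?ji ?scaler0 // -in_fset_set.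
Qed.

Lemma fgen_neq0 (R : comNzRingType) (G : choiceType) (g : G) : fgen R g != 0.
Proof.
apply/eqP => /malgP/(_ (fmu g)); rewrite mcoeffU1 eqxx mcoeff0.
by apply/eqP; exact: oner_neq0.
Qed.

(** A finitely supported sum with infinite support is zero by convention. *)
Lemma fsum_infinite (R : comNzRingType) (G I : choiceType) (D : set I)
    (o : I -> free_alg R G) : (forall i, i \in D -> o i != 0) ->
  infinite_set D -> \sum_(i \in D) o i = 0.
Proof.
move=> o0 infD; apply: fsbig_dflt; rewrite (_ : _ `&` _ = D) //.
by apply/seteqP; split=> [i []//|i Di]; split=> //=; apply/eqP/o0/mem_set.
Qed.

Lemma sum_nat2 (V : nmodType) (F : nat -> V) :
  \sum_(0 <= t < 2) F t = F 0 + F 1.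
Proof. by rewrite big_nat_recr // big_nat1. Qed.

(** * Extension of scalars *)

Section TensorLift.
Variables (A K : comNzRingType) (phi : {rmorphism A -> K}).
Variable (M : lmodType A).

Lemma pureE a (m : M) : pure phi a m = a *: pure phi 1 m.
Proof. by rewrite /GRing.scale /= tpi_scale /zscale /= mulr1. Qed.

Lemma pure1D : {morph pure phi 1 : m m' / m + m' :> M >-> m + m'}.
Proof. by move=> m m'; rewrite -tpiD; apply/tpiP; exact: tensor_Dr. Qed.

Lemma pure1Z c (m : M) : pure phi 1 (c *: m) = phi c *: pure phi 1 m.
Proof.
by rewrite -pureE -[phi c]mul1r; apply/esym/tpiP; exact: tensor_Z.
Qed.

Lemma tensor_pure_ind (P : tensor phi M -> Prop) :
  P 0 -> (forall u w, P u -> P w -> P (u + w)) ->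
  (forall a m, P (a *: pure phi 1 m)) -> forall u, P u.
Proof.
move=> P0 PD Ppure; elim/tensorW; elim=> [|[a m] s IHs]; first exact: P0.
by rewrite -cat1s tpiD; apply: PD => //; rewrite -[tpi _ _]/(pure phi a m) pureE.
Qed.

Variables (N : lmodType K) (g : M -> N).
Hypothesis gD : {morph g : m m' / m + m'}.
Hypothesis gZ : forall c m, g (c *: m) = phi c *: g m.

(** The universal property of extension of scalars, for a map that is semilinear
    along [phi]. *)
Definition tensor_lift (u : tensor phi M) : N := \sum_(p <- repr u) p.1 *: g p.2.

Lemma tensor_lift_tpi s : tensor_lift (tpi phi s) = \sum_(p <- s) p.1 *: g p.2.
Proof.
rewrite /tensor_lift.
have /tpiP : tpi phi (repr (tpi phi s)) = tpi phi s by exact: tpi_repr.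
move: (repr _) => t; elim=> {s t} [//|t u _ ->//|t u w _ -> _ -> //
  |t t' u u' _ Et _ Eu|t u|m|a b m|a m m'|a r m].
- by rewrite !big_cat /= Et Eu.
- by rewrite !big_cat /= addrC.
- by rewrite big_seq1 scale0r big_nil.
- by rewrite !big_cons !big_nil !addr0 scalerDl.
- by rewrite !big_cons !big_nil !addr0 /= gD scalerDr.
- by rewrite !big_seq1 /= gZ scalerA.
Qed.

Lemma tensor_lift_pure m : tensor_lift (pure phi 1 m) = g m.
Proof. by rewrite tensor_lift_tpi big_seq1 scale1r. Qed.

Lemma tensor_liftD : {morph tensor_lift : u w / u + w}.
Proof.
elim/tensorW=> s; elim/tensorW=> t.
by rewrite -tpiD !tensor_lift_tpi big_cat.
Qed.

Lemma tensor_liftZ : scalable tensor_lift.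
Proof.
move=> a; elim/tensorW=> s.
rewrite {1}/GRing.scale /= tpi_scale !tensor_lift_tpi big_map scaler_sumr.
by apply: eq_bigr => p _; rewrite scalerA.
Qed.
End TensorLift.

Section TensorIncl.
Variables (A K : comNzRingType) (phi : {rmorphism A -> K}) (G : choiceType).
Variable rel : free_alg A G -> free_alg A G -> Prop.
Local Notation B := (palg rel).
Local Notation T := (tensor phi B).

Definition tensor_incl (x : B) : T := pure phi 1 x.

Lemma tensor_incl_is_zmod_morphism : zmod_morphism tensor_incl.
Proof.
move=> x y; rewrite /tensor_incl -scaleN1r pure1D pure1Z rmorphN1.
by rewrite scaleN1r.
Qed.
HB.instance Definition _ :=
  GRing.isZmodMorphism.Build B T tensor_incl tensor_incl_is_zmod_morphism.

Lemma tensor_incl_is_monoid_morphism : monoid_morphism tensor_incl.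
Proof. by split=> // x y; rewrite /tensor_incl tpure_mul mulr1. Qed.
HB.instance Definition _ :=
  GRing.isMonoidMorphism.Build B T tensor_incl tensor_incl_is_monoid_morphism.

Lemma tensor_inclZ c x : tensor_incl (c *: x) = phi c *: tensor_incl x.
Proof. exact: pure1Z. Qed.

End TensorIncl.

(** * Identities between quantum integers *)

Section QuantumIdentities.
Variables (K : fieldType) (q : K).
Hypothesis q_neq0 : q != 0.
Hypothesis q_generic : forall s : nat, (0 < s)%N -> q ^+ s != 1.

Lemma qdiff_generic (s : nat) : (0 < s)%N -> q ^ s%:Z - q ^ (- s%:Z) != 0.
Proof. by move=> s0; apply: qdiff_neq0 => //; rewrite q_generic // addn_gt0 s0. Qed.

Lemma qdenom_neq0 : q - q^-1 != 0.
Proof. by have := @qdiff_generic 1 isT; rewrite expr1z. Qed.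

Lemma qint_nat_neq0 s : qint q s.+1%:Z != 0.
Proof. by rewrite mulf_neq0 ?invr_eq0 ?qdenom_neq0 ?qdiff_generic. Qed.

Lemma qint0 : qint q 0 = 0.
Proof. by rewrite /qint oppr0 subrr mul0r. Qed.

Lemma qint1 : qint q 1 = 1.
Proof. by rewrite /qint expr1z -[q ^ (- 1)]/(q^-1) divff // qdenom_neq0. Qed.

Lemma qintN a : qint q (- a) = - qint q a.
Proof. by rewrite /qint opprK -mulNr opprB. Qed.

Lemma qfactS t : qfact q t.+1 = qfact q t * qint q t.+1%:Z.
Proof. by rewrite /qfact big_nat_recr. Qed.

Lemma qfact0 : qfact q 0 = 1.
Proof. by rewrite /qfact big_geq. Qed.

Lemma qfact_neq0 t : qfact q t != 0.
Proof.
elim: t => [|t IHt]; rewrite ?qfact0 ?oner_neq0 //.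
by rewrite qfactS mulf_neq0 ?qint_nat_neq0.
Qed.

Lemma qbin0 a : qbin q a 0 = 1.
Proof. by rewrite /qbin !big_geq // divr1. Qed.

Lemma qdiffE a : q ^ a - q ^ (- a) = qint q a * (q - q^-1).
Proof. by rewrite /qint divfK // qdenom_neq0. Qed.

Lemma qbinSr a t :
  qbin q a t.+1 * qint q t.+1%:Z = qbin q a t * qint q (a - t%:Z).
Proof.
rewrite /qbin; set D := \prod_(1 <= s < t.+1) _.
rewrite [\prod_(1 <= s < t.+2) _]big_nat_recr //= -/D big_nat_recr //=.
set N := \prod_(0 <= s < t) _.
have -> : - a + t%:Z = - (a - t%:Z) by ring.
rewrite !qdiffE.
have D0 : D != 0.
  rewrite prodf_seq_neq0; apply/allP => s; rewrite mem_index_iota => /andP[s0 _].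
  exact: qdiff_generic.
move: (q - q^-1) qdenom_neq0 => w w0.
by field; rewrite D0 qint_nat_neq0 w0.
Qed.

Lemma qbin1 a : qbin q a 1 = qint q a.
Proof. by have := qbinSr a 0; rewrite qint1 mulr1 qbin0 mul1r subr0. Qed.

Lemma qbinSl a t :
  qbin q (a + 1) t.+1 * qint q t.+1%:Z = qint q (a + 1) * qbin q a t.
Proof.
elim: t => [|t IHt].
  by rewrite qbinSr !qbin0 mulr1 mul1r subr0.
apply: (mulIf (qint_nat_neq0 t)).
rewrite qbinSr mulrAC IHt -[LHS]mulrA -[RHS]mulrA qbinSr.
by congr (_ * (_ * qint q _)); rewrite -[t.+1]addn1 PoszD; ring.
Qed.

(** Of the eight powers of [q] on the right, four cancel and the others are
    those on the left.  The case [t = 1] moves one [e] past [f ^+ b]; the general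
    case is the induction step of the commutation formula. *)
Lemma qint_mulE m n t : qint q m * qint q n =
  qint q (m - t) * qint q (n - t) + qint q t * qint q (m + n - t).
Proof.
rewrite /qint !opprD !opprK !(expfzDr _ _ q_neq0) -!invr_expz.
have := expfz_neq0 m q_neq0; have := expfz_neq0 n q_neq0.
have := expfz_neq0 t q_neq0; have := qdenom_neq0.
move: (q ^ m) (q ^ n) (q ^ t) (q - q^-1) => x y z w w0 z0 y0 x0.
by field; rewrite w0 z0 y0 x0.
Qed.

Lemma qbin_fact a b :
  qbin q (a + b)%:Z a = qfact q (a + b) / (qfact q a * qfact q b).
Proof.
elim: a b => [|a IHa] b.
  by rewrite qbin0 qfact0 mul1r divff // qfact_neq0.
apply: (mulIf (qint_nat_neq0 a)).
have E : (a + b).+1%:Z = (a + b)%N%:Z + 1 by rewrite -addn1 PoszD.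
rewrite addSn {1}E qbinSl IHa !qfactS -E.
by field; rewrite !qfact_neq0 qint_nat_neq0.
Qed.
End QuantumIdentities.

(** * Divided powers and rank one commutation *)

Section DividedPowers.
Variables (K : fieldType) (q : K) (G : choiceType).
Variable rel : free_alg K G -> free_alg K G -> Prop.
Local Notation A := (palg rel).
Hypothesis q_neq0 : q != 0.
Hypothesis q_generic : forall s : nat, (0 < s)%N -> q ^+ s != 1.

Definition dpow (x : A) (m : nat) : A := (qfact q m)^-1 *: x ^+ m.

(** The divided power of exponent [m - t], zero when this is negative; with
    truncated subtraction alone, the sums below could not run past [m]. *)
Definition dpow_sub (x : A) (m t : nat) : A :=
  if (t <= m)%N then dpow x (m - t) else 0.

Lemma dpow0 x : dpow x 0 = 1.
Proof. by rewrite /dpow qfact0 invr1 scale1r expr0. Qed.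

Lemma dpow1 x : dpow x 1 = x.
Proof. by rewrite /dpow qfactS qfact0 mul1r qint1 // invr1 scale1r expr1. Qed.

Lemma dpowS x m : qint q m.+1%:Z *: dpow x m.+1 = x * dpow x m.
Proof.
rewrite /dpow -palg_scalerAr -exprS scalerA qfactS invfM mulrC.
by rewrite divfK // qint_nat_neq0.
Qed.

Lemma dpowM x a b : dpow x a * dpow x b = qbin q (a + b)%:Z a *: dpow x (a + b).
Proof.
rewrite /dpow -palg_scalerAl -palg_scalerAr !scalerA -exprD; congr (_ *: _).
by rewrite qbin_fact //; field; rewrite !qfact_neq0.
Qed.

Lemma dpow_slide x (o : int -> A) s : (forall k, x * o k = o (k + s) * x) ->
  forall m k, dpow x m * o k = o (k + s * m%:Z) * dpow x m.
Proof.
move=> xo m k; rewrite /dpow -palg_scalerAl -palg_scalerAr; congr (_ *: _).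
elim: m => [|m IHm]; first by rewrite !expr0 mulr0 addr0 mul1r mulr1.
rewrite exprS -mulrA IHm mulrA xo -mulrA; congr (o _ * _).
by rewrite -[m.+1]addn1 PoszD; ring.
Qed.

(** [o k] plays the role of the idempotent of the weight [l + k alpha_i], where
    [c] is the pairing of [l] with the coroot. *)
Section Rank1.
Variables (e f : A) (o : int -> A) (c : int).
Hypothesis eo : forall k, e * o k = o (k + 1) * e.
Hypothesis fo : forall k, f * o k = o (k - 1) * f.
Hypothesis efo : forall k, (e * f - f * e) * o k = qint q (c + 2 * k) *: o k.

(** Each [f] crossed by [e] contributes one quantum integer; their sum is a
    product of two by [qint_mulE] at [t = 1]. *)
Lemma commute_e_fexp b k : e * f ^+ b * o k = f ^+ b * e * o k +
  (qint q b%:Z * qint q (c + 2 * k - b%:Z + 1)) *: (f ^+ b.-1 * o k).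
Proof.
elim: b k => [|b IHb] k.
  by rewrite qint0 mul0r scale0r addr0 expr0 mulr1 mul1r.
rewrite exprSr mulrA -mulrA fo mulrA IHb mulrDl.
have -> : f ^+ b * e * o (k - 1) * f = f ^+ b.+1 * e * o k
   + qint q (c + 2 * k) *: (f ^+ b * o k).
  rewrite -mulrA -fo palg_scalerAr -efo exprSr !mulrA -mulrDl; congr (_ * _).
  by rewrite mulrBr !mulrA addrC subrK.
rewrite -addrA; congr (_ + _); first by rewrite exprSr.
have -> : qint q b%:Z * qint q (c + 2 * (k - 1) - b%:Z + 1) *:
     (f ^+ b.-1 * o (k - 1)) * f
   = (qint q b%:Z * qint q (c + 2 * (k - 1) - b%:Z + 1)) *: (f ^+ b * o k).
  rewrite -palg_scalerAl -mulrA -fo mulrA -exprSr.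
  by case: b {IHb} => [|b] //; rewrite qint0 mul0r !scale0r.
rewrite -scalerDl; congr (_ *: _).
rewrite (qint_mulE q_neq0 q_generic b.+1%:Z _ 1) qint1 // mul1r addrC.
have Sb : b.+1%:Z = b%:Z + 1 by rewrite -addn1 PoszD.
by congr (qint q _ * qint q _ + qint q _); rewrite Sb; ring.
Qed.

Lemma commute_e_fdpow b k : e * dpow f b * o k = dpow f b * e * o k +
  qint q (c + 2 * k - b%:Z + 1) *: (dpow_sub f b 1 * o k).
Proof.
rewrite /dpow -palg_scalerAr -!palg_scalerAl commute_e_fexp scalerDr; congr (_ + _).
rewrite scalerA; case: b => [|b].
  by rewrite qint0 mul0r mulr0 scale0r /dpow_sub mul0r scaler0.
rewrite /dpow_sub subn1 /= /dpow -palg_scalerAl scalerA; congr (_ *: _).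
by rewrite qfactS; field; rewrite qfact_neq0 // qint_nat_neq0.
Qed.

Lemma commute_e_fdpow_sub b t k : e * dpow_sub f b t * o k =
  dpow_sub f b t * e * o k +
  qint q (c + 2 * k - b%:Z + t%:Z + 1) *: (dpow_sub f b t.+1 * o k).
Proof.
rewrite {1 2}/dpow_sub; case: leqP => [tb|bt]; last first.
  by rewrite /dpow_sub leqNgt ltnS (ltnW bt) /= mulr0 !mul0r scaler0 addr0.
rewrite commute_e_fdpow /dpow_sub subn_gt0 -subnDA addn1 -subzn //.
by congr (_ + qint q _ *: _); ring.
Qed.

Lemma commute_e_straightened a b t k : (t <= a)%N ->
  e * (dpow_sub f b t * dpow e (a - t) * o k) =
    qint q (a.+1%:Z - t%:Z) *: (dpow_sub f b t * dpow e (a.+1 - t) * o k) +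
    qint q (a%:Z - b%:Z + c + 2 * k + a.+1%:Z - t%:Z) *:
      (dpow_sub f b t.+1 * dpow e (a.+1 - t.+1) * o k).
Proof.
move=> ta; rewrite subSS (subSn ta).
have Sa : a.+1%:Z = a%:Z + 1 by rewrite -addn1 PoszD.
have -> : a.+1%:Z - t%:Z = (a - t).+1%:Z by rewrite -subSn // subzn // leqW.
rewrite -mulrA (dpow_slide eo) 2!mulrA commute_e_fdpow_sub mulrDl; congr (_ + _).
  rewrite -!mulrA -(dpow_slide eo) (mulrA e) -dpowS.
  by rewrite -palg_scalerAl -palg_scalerAr.
rewrite -palg_scalerAl -!mulrA -(dpow_slide eo); congr (qint q _ *: _).
by rewrite -subzn // Sa; ring.
Qed.

(** Induction on [a]: multiplying by [e] turns the term of index [t] into terms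
    of index [t] and [t.+1], and the new coefficients satisfy the recursion of
    the quantum binomials by [qint_mulE]. *)
Lemma dpow_commutation a b k : dpow e a * dpow f b * o k =
  \sum_(0 <= t < a.+1) qbin q (a%:Z - b%:Z + c + 2 * k) t *:
     (dpow_sub f b t * dpow e (a - t) * o k).
Proof.
elim: a => [|a IHa].
  by rewrite big_nat1 qbin0 scale1r dpow0 mul1r mulr1 /dpow_sub subn0.
have -> : a.+1%:Z - b%:Z + c + 2 * k = (a%:Z - b%:Z + c + 2 * k) + 1.
  by rewrite -addn1 PoszD; ring.
apply: (@scalerI _ _ (qint q a.+1%:Z)); first exact: qint_nat_neq0.
rewrite !palg_scalerAl dpowS -!mulrA [X in e * X]mulrA IHa mulr_sumr scaler_sumr.
set x := a%:Z - b%:Z + c + 2 * k.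
pose D t := dpow_sub f b t * dpow e (a.+1 - t) * o k.
pose r t := qbin q x t * qint q (a.+1%:Z - t%:Z).
pose s t := qbin q x t * qint q (x + a.+1%:Z - t%:Z).
transitivity (\sum_(0 <= t < a.+1) (r t *: D t + s t *: D t.+1)).
  apply: eq_big_nat => t /andP[_ ta].
  by rewrite -palg_scalerAr commute_e_straightened // scalerDr !scalerA.
(* The coefficient [r] vanishes at [a.+1], so its sum may be extended to the
   range that the right-hand side has. *)
have r0 : r a.+1 = 0 by rewrite /r subrr qint0 mulr0.
have rD : \sum_(0 <= t < a.+1) r t *: D t = \sum_(0 <= t < a.+2) r t *: D t.
  by rewrite [RHS]big_nat_recr //= r0 scale0r addr0.
rewrite big_split /= rD.
rewrite !(big_nat_recl a.+1) //= -addrA -big_split /=; congr (_ + _).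
  by rewrite /r !qbin0 subr0 mul1r scale1r.
apply: eq_big_nat => t _; rewrite -scalerDl scalerA; congr (_ *: _).
(* After multiplication by [t.+1] both sides are multiples of [qbin q x t]. *)
apply: (mulIf (qint_nat_neq0 q_neq0 q_generic t)).
rewrite -[RHS]mulrA qbinSl // mulrDl /r [in LHS]mulrAC qbinSr //.
have Sa : a.+1%:Z = a%:Z + 1 by rewrite -addn1 PoszD.
have St : t.+1%:Z = t%:Z + 1 by rewrite -addn1 PoszD.
rewrite [RHS]mulrA (qint_mulE q_neq0 q_generic a.+1%:Z (x + 1) t.+1%:Z) /s.
have -> : x + 1 - t.+1%:Z = x - t%:Z by rewrite St; ring.
have -> : a.+1%:Z + (x + 1) - t.+1%:Z = x + a.+1%:Z - t%:Z by rewrite St; ring.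
by ring.
Qed.

(** [o 0] slides past the divided power of [f] to become [o b]; taking [k = b]
    turns the argument [a - b + c + 2 k] of the binomials into [a + b + c]. *)
Lemma dpow_sandwich a b : dpow e a * o 0 * dpow f b =
  \sum_(0 <= t < (minn a b).+1) qbin q ((a + b)%:Z + c) t *:
     (dpow f (b - t) * o (a + b - t)%:Z * dpow e (a - t)).
Proof.
have ob : o 0 * dpow f b = dpow f b * o b%:Z.
  by rewrite (dpow_slide fo); congr (o _ * _); ring.
rewrite -mulrA ob mulrA dpow_commutation.
rewrite (@big_cat_nat _ _ _ (minn a b).+1) //= ?ltnS ?geq_minl //.
rewrite [X in _ + X]big1_seq ?addr0; last first.
  move=> t; rewrite mem_index_iota ltnS gtn_min => /and3P[_ /orP[at_|bt] ta].
    by rewrite ltnNge ta in at_.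
  by rewrite /dpow_sub leqNgt bt /= !mul0r scaler0.
apply: eq_big_nat => t /andP[_]; rewrite ltnS leq_min => /andP[ta tb].
rewrite /dpow_sub tb -!mulrA (dpow_slide eo); congr (qbin q _ _ *: (_ * (o _ * _))).
  by rewrite PoszD; ring.
by rewrite -!subzn // ?PoszD ?(leq_trans ta) ?leq_addr //; ring.
Qed.
End Rank1.
End DividedPowers.

(** The families of divided powers live in two kinds of algebra, quotients of
    free algebras and tensor products; the next two lemmas treat both through
    the central morphism [phi]. *)
Section DividedFamily.
Variables (K : fieldType) (q : K) (A : pzRingType) (phi : {rmorphism K -> A}).
Hypothesis q_neq0 : q != 0.
Hypothesis q_generic : forall s : nat, (0 < s)%N -> q ^+ s != 1.
Hypothesis phi_central : forall c x, phi c * x = x * phi c.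

Lemma divided_exp (x : nat -> A) : x 0 = 1 ->
  (forall a b, x a * x b = phi (qbin q (a + b)%:Z a) * x (a + b)%N) ->
  forall m, x 1 ^+ m = phi (qfact q m) * x m.
Proof.
move=> x0 xM; elim=> [|m IHm]; first by rewrite expr0 qfact0 rmorph1 x0 mulr1.
rewrite exprS IHm mulrA -phi_central -mulrA xM (qbin1 q_neq0 q_generic).
by rewrite mulrA -rmorphM qfactS.
Qed.

(** [[m choose s] = [m]! / ([s]! [m-s]!)], so the factorials of the two divided
    powers around [y] turn each binomial into the common factor [[m]!]. *)
Lemma divided_serre (x : nat -> A) (y : A) m :
  (forall s, x 1 ^+ s = phi (qfact q s) * x s) ->
  \sum_(0 <= s < m.+1) phi ((-1) ^+ s * qbin q m%:Z s) *
     (x 1 ^+ (m - s) * y * x 1 ^+ s)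
  = phi (qfact q m) * \sum_(0 <= s < m.+1) (-1) ^+ s * x (m - s)%N * y * x s.
Proof.
move=> xX; rewrite mulr_sumr; apply: eq_big_nat => s; rewrite ltnS /= => sm.
have pull a b X Z : phi a * X * y * (phi b * Z) = phi (a * b) * (X * y * Z).
  by rewrite rmorphM -!mulrA; congr (_ * _); rewrite !mulrA -phi_central -!mulrA.
have -> : (-1) ^+ s * x (m - s)%N * y * x s =
    phi ((-1) ^+ s) * (x (m - s)%N * y * x s).
  by rewrite rmorphXn rmorphN1 !mulrA.
rewrite !xX pull [LHS]mulrA [RHS]mulrA -!rmorphM; congr (phi _ * _).
rewrite -{1}(subnKC sm) qbin_fact // subnKC //.
by field; rewrite !qfact_neq0.
Qed.
End DividedFamily.

Section DividedPowerSerre.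
Variables (K : fieldType) (q : K) (G : choiceType).
Variable rel : free_alg K G -> free_alg K G -> Prop.
Hypothesis q_neq0 : q != 0.
Hypothesis q_generic : forall s : nat, (0 < s)%N -> q ^+ s != 1.

Lemma dpow_exp (x : palg rel) m :
  dpow q x 1 ^+ m = palg_scalar rel (qfact q m) * dpow q x m.
Proof.
by rewrite dpow1 // palg_scalarE /dpow scalerA divff ?scale1r // qfact_neq0.
Qed.

Lemma dpow_serre (x y : palg rel) (m : nat) :
  \sum_(0 <= s < m.+1) ((-1) ^+ s * qbin q m%:Z s) *:
    (x ^+ (m - s) * y * x ^+ s) = 0 ->
  \sum_(0 <= s < m.+1) (-1) ^+ s * dpow q x (m - s) * y * dpow q x s = 0.
Proof.
move=> serre0; apply: (@scalerI _ _ (qfact q m)); first exact: qfact_neq0.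
rewrite scaler0 -palg_scalarE -(divided_serre q_neq0 q_generic
  (@palg_scalar_central _ _ rel) _ _ (dpow_exp x)) -[RHS]serre0.
by apply: eq_bigr => s _; rewrite palg_scalarE dpow1.
Qed.
End DividedPowerSerre.

(** * The integral relations hold in S *)

Section Quantum.
Variables (n : nat) (C : 'M[int]_n) (d : 'I_n -> nat) (pi : set (weight n)).
Hypothesis cartan : finite_cartan C d.
Local Notation Wpi := (weyl_orbits C pi).
Local Notation alpha := (simple_root C).
Local Notation vi i := (v ^+ d i).

Lemma vi_neq0 i : vi i != 0.
Proof. by rewrite expf_neq0 // v_neq0. Qed.

Lemma vi_generic i (s : nat) : (0 < s)%N -> vi i ^+ s != 1.
Proof.
move=> s0; rewrite -exprM v_expn_neq1 // muln_gt0 s0 andbT.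
by case: cartan => _ _ /(_ i) + _ _; rewrite !inE => /or3P[] /eqP ->.
Qed.

Lemma pairing_line i l (k : int) :
  pairing i (l + alpha i *~ k) = pairing i l + 2 * k.
Proof.
rewrite -scaler_int /pairing !mxE intz mulrC.
by case: cartan => ->.
Qed.

Section SSide.
Local Notation rS := (@S_rel n C d pi).
Local Notation S := (palg rS).
Local Notation E i := (ppi rS (S_e C pi i)).
Local Notation F i := (ppi rS (S_f C pi i)).
Local Notation "'1_' l" := (ppi rS (S_o C pi l)) (at level 2, l at level 1).

Lemma S_1_out l : l \notin Wpi -> 1_l = 0.
Proof. by move=> lW; rewrite /S_o insubN // raddf0. Qed.

Lemma S_1_mul l m : l \in Wpi -> m \in Wpi -> 1_l * 1_m = if l == m then 1_l else 0.
Proof.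
move=> lW mW; rewrite -[LHS]rmorphM /= (ppi_rel (S_idem d lW mW)).
by case: ifP => _; rewrite ?raddf0.
Qed.

(** For an infinite orbit set the relation on the sum of the idempotents reads
    [0 = 1]. *)
Lemma S_infinite (x : S) : infinite_set Wpi -> x = 0.
Proof.
move=> infW; rewrite -[x]mul1r -[1]/(ppi rS 1) -(ppi_rel (S_unit C d pi)).
rewrite fsum_infinite ?raddf0 ?mul0r // => l lW.
by rewrite /S_o insubT fgen_neq0.
Qed.

Lemma S_sum_1 : finite_set Wpi -> \sum_(l \in Wpi) 1_l = 1.
Proof.
move=> finW; rewrite -[RHS]/(ppi rS 1) -(ppi_rel (S_unit C d pi)).
exact/esym/raddf_fsum.
Qed.

(** The two relations moving [1_l] across [E_i] combine into one that needs no
    condition on [l]: if only one of [l] and [l + alpha i] lies in the orbit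
    set, one side is a zero idempotent and a relation kills the other. *)
Lemma S_E_slide i l : E i * 1_l = 1_(l + alpha i) * E i.
Proof.
have [lW|lW] := boolP (l \in Wpi).
  rewrite -[LHS]rmorphM /= (ppi_rel (S_E1 d i lW)); case: ifP => aW.
    by rewrite rmorphM.
  by rewrite raddf0 S_1_out ?aW ?mul0r.
rewrite S_1_out // mulr0; have [aW|aW] := boolP (l + alpha i \in Wpi); last first.
  by rewrite S_1_out ?mul0r.
rewrite -[RHS]rmorphM /= (ppi_rel (S_1E d i aW)) addrK (negPf lW).
by rewrite raddf0.
Qed.

Lemma S_F_slide i l : F i * 1_l = 1_(l - alpha i) * F i.
Proof.
have [lW|lW] := boolP (l \in Wpi).
  rewrite -[LHS]rmorphM /= (ppi_rel (S_F1 d i lW)); case: ifP => aW.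
    by rewrite rmorphM.
  by rewrite raddf0 S_1_out ?aW ?mul0r.
rewrite S_1_out // mulr0; have [aW|aW] := boolP (l - alpha i \in Wpi); last first.
  by rewrite S_1_out ?mul0r.
rewrite -[RHS]rmorphM /= (ppi_rel (S_1F d i aW)) subrK (negPf lW).
by rewrite raddf0.
Qed.

Lemma S_EF_comm i j : i != j -> E i * F j = F j * E i.
Proof.
move=> ij; apply/eqP; rewrite -subr_eq0 -[E i * F j]rmorphM -[F j * E i]rmorphM.
by rewrite -rmorphB /= (ppi_rel (S_EF C d pi i j)) (negPf ij) raddf0.
Qed.

Lemma S_EF_1 i l : (E i * F i - F i * E i) * 1_l = qint (vi i) (pairing i l) *: 1_l.
Proof.
have [finW|] := pselect (finite_set Wpi); last first.
  by move=> /S_infinite S0; rewrite [LHS]S0 [RHS]S0.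
have [lW|lW] := boolP (l \in Wpi); last by rewrite S_1_out // mulr0 scaler0.
rewrite -[E i * F i]rmorphM -[F i * E i]rmorphM -rmorphB /=.
rewrite (ppi_rel (S_EF C d pi i i)) eqxx.
rewrite (ppi_orthogonal_sum (fun m => qint (vi i) (pairing i m))) // => m mW.
exact: S_1_mul.
Qed.

Definition weight_line i l (k : int) : S := 1_(l + alpha i *~ k).

Lemma S_E_line i l k :
  E i * weight_line i l k = weight_line i l (k + 1) * E i.
Proof. by rewrite /weight_line S_E_slide mulrzDr addrA. Qed.

Lemma S_F_line i l k :
  F i * weight_line i l k = weight_line i l (k - 1) * F i.
Proof. by rewrite /weight_line S_F_slide mulrzBr addrA. Qed.

Lemma S_dpowE_slide i a l :
  dpow (vi i) (E i) a * 1_l = 1_(l + alpha i *+ a) * dpow (vi i) (E i) a.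
Proof.
have := dpow_slide (vi i) (S_E_line i l) a 0.
by rewrite /weight_line mulr0z addr0 add0r mul1r.
Qed.

Lemma S_dpowF_slide i b l :
  dpow (vi i) (F i) b * 1_l = 1_(l - alpha i *+ b) * dpow (vi i) (F i) b.
Proof.
have := dpow_slide (vi i) (S_F_line i l) b 0.
by rewrite /weight_line mulr0z addr0 add0r mulN1r mulrNz.
Qed.

Lemma S_E1F i a b l : dpow (vi i) (E i) a * 1_(- l) * dpow (vi i) (F i) b =
  \sum_(0 <= t < (minn a b).+1) qbin (vi i) ((a + b)%:Z - pairing i l) t *:
    (dpow (vi i) (F i) (b - t) * 1_(- l + alpha i *+ (a + b - t)) *
     dpow (vi i) (E i) (a - t)).
Proof.
have EFline k : (E i * F i - F i * E i) * weight_line i (- l) k =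
    qint (vi i) (- pairing i l + 2 * k) *: weight_line i (- l) k.
  by rewrite S_EF_1 pairing_line /pairing mxE.
have := dpow_sandwich (vi_neq0 i) (@vi_generic i) (S_E_line i (- l))
  (S_F_line i (- l)) EFline a b.
by rewrite /weight_line mulr0z addr0.
Qed.

(** The rank one formula with the roles of [e] and [f] exchanged, read along the
    weight line in the opposite direction. *)
Lemma S_F1E i a b l : dpow (vi i) (F i) b * 1_l * dpow (vi i) (E i) a =
  \sum_(0 <= t < (minn a b).+1) qbin (vi i) ((a + b)%:Z - pairing i l) t *:
    (dpow (vi i) (E i) (a - t) * 1_(l - alpha i *+ (a + b - t)) *
     dpow (vi i) (F i) (b - t)).
Proof.
pose o k := weight_line i l (- k).
have Fo k : F i * o k = o (k + 1) * F i by rewrite /o opprD S_F_line.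
have Eo k : E i * o k = o (k - 1) * E i by rewrite /o opprB addrC S_E_line addrC.
have FEo k : (F i * E i - E i * F i) * o k =
    qint (vi i) (- pairing i l + 2 * k) *: o k.
  rewrite -opprB mulNr S_EF_1 pairing_line -scaleNr -qintN //.
  by congr (qint _ _ *: _); ring.
have := dpow_sandwich (vi_neq0 i) (@vi_generic i) Fo Eo FEo b a.
rewrite {1}/o /weight_line oppr0 mulr0z addr0 minnC [(b + a)%N]addnC => ->.
by apply: eq_bigr => t _; rewrite /o /weight_line mulrNz.
Qed.

Lemma S_dpowEF_comm i j a b : i != j ->
  dpow (vi i) (E i) a * dpow (vi j) (F j) b =
  dpow (vi j) (F j) b * dpow (vi i) (E i) a.
Proof.
move=> ij; rewrite /dpow -!palg_scalerAl -!palg_scalerAr !scalerA mulrC.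
by congr (_ *: _); apply/commrX/commr_sym/commrX/commr_sym/S_EF_comm.
Qed.

Definition S_scalar (c : zlaurent) : S := palg_scalar rS (zl_val c).
HB.instance Definition _ := GRing.RMorphism.copy S_scalar (palg_scalar rS \o zl_val).

Lemma S_scalar_central c x : S_scalar c * x = x * S_scalar c.
Proof. exact: palg_scalar_central. Qed.

Definition S_divided (g : T_gen C pi) : S :=
  match g with
  | inl (inl (i, a)) => dpow (vi i) (E i) a
  | inl (inr (i, b)) => dpow (vi i) (F i) b
  | inr l => 1_(val l)
  end.

(** Noncommutative polynomials in the integral generators, evaluated in [S]. *)
Definition T_eval := free_lift S_scalar S_divided.
HB.instance Definition _ := GRing.isZmodMorphism.Build _ S T_eval
  (free_lift_is_zmod_morphism S_scalar S_divided).
HB.instance Definition _ := GRing.isMonoidMorphism.Build _ S T_eval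
  (free_lift_is_monoid_morphism S_scalar_central S_divided).

Lemma T_evalZ c x : T_eval (c *: x) = zl_val c *: T_eval x.
Proof. by rewrite /T_eval free_liftZ -palg_scalarE. Qed.

Lemma T_eval_e i a : T_eval (T_e C pi i a) = dpow (vi i) (E i) a.
Proof. exact: free_lift_gen. Qed.

Lemma T_eval_f i a : T_eval (T_f C pi i a) = dpow (vi i) (F i) a.
Proof. exact: free_lift_gen. Qed.

Lemma T_eval_o l : T_eval (T_o C pi l) = 1_l.
Proof.
have [lW|lW] := boolP (l \in Wpi); last by rewrite /T_o insubN // S_1_out ?raddf0.
by rewrite /T_o (insubT (fun l => l \in Wpi) lW) [LHS]free_lift_gen.
Qed.

Let T_evalE := (T_eval_e, T_eval_f, T_eval_o).

Lemma T_eval_rel x y : @T_rel n C d pi x y -> T_eval x = T_eval y.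
Proof.
have q0 := vi_neq0; have qg := vi_generic.
case=> {x y} [l m lW mW||i a b|i a b|i|i|i j a b ij|i a b l|i a b l|i a l lW
  |i b l lW|i a l lW|i b l lW|i j ij m|i j ij m].
- by rewrite rmorphM /= !T_evalE S_1_mul //; case: ifP => _; rewrite ?T_evalE ?raddf0.
- have [finW|] := pselect (finite_set Wpi); last first.
    by move=> /S_infinite S0; rewrite [LHS]S0 [RHS]S0.
  rewrite rmorph1 raddf_fsum // -S_sum_1 //; apply: eq_fsbigr => l _.
  exact: T_eval_o.
- by rewrite T_evalZ rmorphM /= !T_evalE (dpowM (q0 i) (qg i)).
- by rewrite T_evalZ rmorphM /= !T_evalE (dpowM (q0 i) (qg i)).
- by rewrite T_evalE dpow0 rmorph1.
- by rewrite T_evalE dpow0 rmorph1.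
- rewrite [LHS]rmorphM [RHS]rmorphM /= !T_evalE; exact: S_dpowEF_comm.
- rewrite !rmorphM /= !T_evalE S_E1F raddf_sum; apply: eq_bigr => t _.
  by rewrite /= T_evalZ !rmorphM /= !T_evalE.
- rewrite !rmorphM /= !T_evalE S_F1E raddf_sum; apply: eq_bigr => t _.
  by rewrite /= T_evalZ !rmorphM /= !T_evalE.
- rewrite rmorphM /= !T_evalE S_dpowE_slide.
  by case: ifPn => aW; rewrite ?rmorphM /= ?T_evalE // S_1_out // mul0r raddf0.
- rewrite rmorphM /= !T_evalE S_dpowF_slide.
  by case: ifPn => aW; rewrite ?rmorphM /= ?T_evalE // S_1_out // mul0r raddf0.
- rewrite rmorphM /= !T_evalE.
  have -> : 1_l = 1_(l - alpha i *+ a + alpha i *+ a) by rewrite subrK.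
  rewrite -S_dpowE_slide.
  by case: ifPn => aW; rewrite ?rmorphM /= ?T_evalE // S_1_out // mulr0 raddf0.
- rewrite rmorphM /= !T_evalE.
  have -> : 1_l = 1_(l + alpha i *+ b - alpha i *+ b) by rewrite addrK.
  rewrite -S_dpowF_slide.
  by case: ifPn => aW; rewrite ?rmorphM /= ?T_evalE // S_1_out // mulr0 raddf0.
- rewrite raddf0 raddf_sum /=.
  under eq_bigr => s _ do
    rewrite !rmorphM /= !T_evalE rmorphXn /= rmorphN1 (dpow1 (q0 j) (qg j)).
  apply: (dpow_serre (q0 i) (qg i)); have := ppi_rel (S_serreE C d pi ij).
  by rewrite ppi_serre raddf0.
- rewrite raddf0 raddf_sum /=.
  under eq_bigr => s _ do
    rewrite !rmorphM /= !T_evalE rmorphXn /= rmorphN1 (dpow1 (q0 j) (qg j)).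
  apply: (dpow_serre (q0 i) (qg i)); have := ppi_rel (S_serreF C d pi ij).
  by rewrite ppi_serre raddf0.
Qed.

End SSide.
End Quantum.

(** * The rational relations hold in T *)

Section TSide.
Variables (n : nat) (C : 'M[int]_n) (d : 'I_n -> nat) (pi : set (weight n)).
Hypothesis cartan : finite_cartan C d.
Local Notation Wpi := (weyl_orbits C pi).
Local Notation alpha := (simple_root C).
Local Notation vi i := (v ^+ d i).
Local Notation rT := (@T_rel n C d pi).
Local Notation e i a := (ppi rT (T_e C pi i a)).
Local Notation f i a := (ppi rT (T_f C pi i a)).
Local Notation "'1_' l" := (ppi rT (T_o C pi l)) (at level 2, l at level 1).

Lemma T_1_out l : l \notin Wpi -> 1_l = 0.
Proof. by move=> lW; rewrite /T_o insubN // raddf0. Qed.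

Lemma T_1_mul l m : l \in Wpi -> m \in Wpi -> 1_l * 1_m = if l == m then 1_l else 0.
Proof.
move=> lW mW; rewrite -[LHS]rmorphM /= (ppi_rel (T_idem d lW mW)).
by case: ifP => _; rewrite ?raddf0.
Qed.

Lemma T_infinite (x : palg rT) : infinite_set Wpi -> x = 0.
Proof.
move=> infW; rewrite -[x]mul1r -[1]/(ppi rT 1) -(ppi_rel (T_unit C d pi)).
rewrite fsum_infinite ?raddf0 ?mul0r // => l lW.
by rewrite /T_o insubT fgen_neq0.
Qed.

Lemma T_sum_1 : finite_set Wpi -> \sum_(l \in Wpi) 1_l = 1.
Proof.
move=> finW; rewrite -[RHS]/(ppi rT 1) -(ppi_rel (T_unit C d pi)).
exact/esym/raddf_fsum.
Qed.

Lemma T_E_slide i l : e i 1 * 1_l = 1_(l + alpha i) * e i 1.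
Proof.
have [lW|lW] := boolP (l \in Wpi).
  rewrite -[LHS]rmorphM /= (ppi_rel (T_E1 d i 1 lW)) mulr1n; case: ifP => aW.
    by rewrite rmorphM.
  by rewrite raddf0 T_1_out ?aW ?mul0r.
rewrite T_1_out // mulr0; have [aW|aW] := boolP (l + alpha i \in Wpi); last first.
  by rewrite T_1_out ?mul0r.
rewrite -[RHS]rmorphM /= (ppi_rel (T_1E d i 1 aW)) mulr1n addrK (negPf lW).
by rewrite raddf0.
Qed.

Lemma T_F_slide i l : f i 1 * 1_l = 1_(l - alpha i) * f i 1.
Proof.
have [lW|lW] := boolP (l \in Wpi).
  rewrite -[LHS]rmorphM /= (ppi_rel (T_F1 d i 1 lW)) mulr1n; case: ifP => aW.
    by rewrite rmorphM.
  by rewrite raddf0 T_1_out ?aW ?mul0r.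
rewrite T_1_out // mulr0; have [aW|aW] := boolP (l - alpha i \in Wpi); last first.
  by rewrite T_1_out ?mul0r.
rewrite -[RHS]rmorphM /= (ppi_rel (T_1F d i 1 aW)) mulr1n subrK (negPf lW).
by rewrite raddf0.
Qed.

(** The case [a = b = 1] of the sandwich relation at the weight [l - alpha i],
    whose two outer terms are [1_l e f] and [1_l f e] after sliding. *)
Lemma T_1_EF i l :
  1_l * (e i 1 * f i 1 - f i 1 * e i 1) = zqbin (d i) (pairing i l) 1 *: 1_l.
Proof.
have e0 : e i 0 = 1 by rewrite (ppi_rel (T_E0 C d pi i)) rmorph1.
have f0 : f i 0 = 1 by rewrite (ppi_rel (T_F0 C d pi i)) rmorph1.
have := ppi_rel (T_E1F C d pi i 1 1 (alpha i - l)).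
rewrite minnn sum_nat2.
rewrite [RHS]ppiD [X in _ = X + _]ppi_scale_mul3 [X in _ = _ + X]ppi_scale_mul3.
rewrite [LHS]ppi_mul3.
have mid1 (x : palg rT) : 1 * x * 1 = x by rewrite mul1r mulr1.
rewrite !subn0 !subnn e0 f0 opprB mid1.
have -> : zqbin (d i) ((1 + 1)%N%:Z - pairing i (alpha i - l)) 0 = 1.
  by apply: val_inj; rewrite /= qbin0.
have -> : (1 + 1)%N%:Z - pairing i (alpha i - l) = pairing i l.
  by rewrite /pairing !mxE; case: cartan => -> _ _ _ _; ring.
rewrite scale1r mulr1n mulr2n !addrA subrK => E1F.
have El : 1_l * e i 1 = e i 1 * 1_(l - alpha i) by rewrite T_E_slide subrK.
have Fl : 1_l * f i 1 = f i 1 * 1_(l + alpha i) by rewrite T_F_slide addrK.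
by rewrite mulrBr !mulrA El Fl E1F [LHS]addrC addKr.
Qed.

Lemma T_EF_sum i : finite_set Wpi ->
  e i 1 * f i 1 - f i 1 * e i 1 =
  \sum_(l \in Wpi) zqbin (d i) (pairing i l) 1 *: 1_l.
Proof.
move=> finW; rewrite -[LHS]mul1r -T_sum_1 // !fsbig_finite // mulr_suml.
by apply: eq_bigr => l _; exact: T_1_EF.
Qed.

Lemma T_EF_comm i j : i != j -> e i 1 * f j 1 = f j 1 * e i 1.
Proof.
move=> ij; have := ppi_rel (T_EF C d pi 1 1 ij).
by rewrite [LHS]rmorphM [RHS]rmorphM.
Qed.

Local Notation T := (tensor zl_val (palg rT)).
Local Notation incl := (tensor_incl zl_val (rel := rT)).
Local Notation scal := (tensor_scalar zl_val rT).
Local Notation scal_central := (@tensor_scalar_central _ _ zl_val _ rT).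

Lemma T_divided_mul (x : nat -> free_alg zlaurent (T_gen C pi)) i :
  (forall a b, rT (x a * x b) (zqbin (d i) (a + b)%:Z a *: x (a + b)%N)) ->
  forall a b, incl (ppi rT (x a)) * incl (ppi rT (x b)) =
    scal (qbin (vi i) (a + b)%:Z a) * incl (ppi rT (x (a + b)%N)).
Proof.
move=> xM a b; rewrite -rmorphM -[_ * _]rmorphM /= (ppi_rel (xM a b)) ppiZ.
by rewrite tensor_inclZ tensor_scalarE.
Qed.

Lemma T_e_exp i m : incl (e i 1) ^+ m = scal (qfact (vi i) m) * incl (e i m).
Proof.
apply: (divided_exp (vi_neq0 d i) (@vi_generic _ _ _ cartan i)
  scal_central (x := fun a => incl (e i a))).
  by rewrite (ppi_rel (T_E0 C d pi i)) rmorph1.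
by apply: T_divided_mul => a b; exact: T_EE.
Qed.

Lemma T_f_exp i m : incl (f i 1) ^+ m = scal (qfact (vi i) m) * incl (f i m).
Proof.
apply: (divided_exp (vi_neq0 d i) (@vi_generic _ _ _ cartan i)
  scal_central (x := fun a => incl (f i a))).
  by rewrite (ppi_rel (T_F0 C d pi i)) rmorph1.
by apply: T_divided_mul => a b; exact: T_FF.
Qed.

Definition T_generator (g : S_gen C pi) : T :=
  match g with
  | inl (inl i) => incl (e i 1)
  | inl (inr i) => incl (f i 1)
  | inr l => incl (1_(val l))
  end.

(** Noncommutative polynomials in the generators of [S], evaluated in [T]. *)
Definition S_eval := free_lift scal T_generator.
HB.instance Definition _ := GRing.isZmodMorphism.Build _ T S_eval
  (free_lift_is_zmod_morphism scal T_generator).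
HB.instance Definition _ := GRing.isMonoidMorphism.Build _ T S_eval
  (free_lift_is_monoid_morphism scal_central T_generator).

Lemma S_evalZ c x : S_eval (c *: x) = c *: S_eval x.
Proof. by rewrite /S_eval free_liftZ tensor_scalarE. Qed.

Lemma S_eval_e i : S_eval (S_e C pi i) = incl (e i 1).
Proof. exact: free_lift_gen. Qed.

Lemma S_eval_f i : S_eval (S_f C pi i) = incl (f i 1).
Proof. exact: free_lift_gen. Qed.

Lemma S_eval_o l : S_eval (S_o C pi l) = incl (1_l).
Proof.
have [lW|lW] := boolP (l \in Wpi); last by rewrite /S_o insubN // T_1_out ?raddf0.
by rewrite /S_o (insubT (fun l => l \in Wpi) lW) [LHS]free_lift_gen.
Qed.

Let S_evalE := (S_eval_e, S_eval_f, S_eval_o).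

Lemma S_eval_serre (x y : free_alg Qv (S_gen C pi)) (c : nat -> Qv) m :
  S_eval (\sum_(0 <= s < m.+1) c s *: (x ^+ (m - s) * y * x ^+ s)) =
  \sum_(0 <= s < m.+1) scal (c s) *
    (S_eval x ^+ (m - s) * S_eval y * S_eval x ^+ s).
Proof.
rewrite raddf_sum; apply: eq_bigr => s _ /=.
by rewrite [LHS]S_evalZ -tensor_scalarE !rmorphM !rmorphXn.
Qed.

Lemma incl_serre (x : nat -> free_alg zlaurent (T_gen C pi)) y m :
  incl (ppi rT (\sum_(0 <= s < m.+1) (-1) ^+ s * x (m - s)%N * y * x s)) =
  \sum_(0 <= s < m.+1) (-1) ^+ s * incl (ppi rT (x (m - s)%N)) *
    incl (ppi rT y) * incl (ppi rT (x s)).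
Proof.
rewrite !raddf_sum; apply: eq_bigr => s _ /=.
by rewrite !rmorphM !rmorphXn /= !rmorphN1.
Qed.

Lemma T_serre i (x : nat -> free_alg zlaurent (T_gen C pi)) y m :
  (forall s, incl (ppi rT (x 1)) ^+ s =
    scal (qfact (vi i) s) * incl (ppi rT (x s))) ->
  rT (\sum_(0 <= s < m.+1) (-1) ^+ s * x (m - s)%N * y * x s) 0 ->
  \sum_(0 <= s < m.+1) scal ((-1) ^+ s * qbin (vi i) m%:Z s) *
    (incl (ppi rT (x 1)) ^+ (m - s) * incl (ppi rT y) * incl (ppi rT (x 1)) ^+ s) = 0.
Proof.
move=> xX /ppi_rel serre0.
rewrite (divided_serre (vi_neq0 d i) (@vi_generic _ _ _ cartan i)
  scal_central (x := fun a => incl (ppi rT (x a)))) //.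
by rewrite -incl_serre serre0 !raddf0 mulr0.
Qed.

Lemma S_eval_rel x y : @S_rel n C d pi x y -> S_eval x = S_eval y.
Proof.
have T0 (u w : T) : infinite_set Wpi -> u = w.
  move=> infW; rewrite -[u]mul1r -[w]mul1r -(rmorph1 incl).
  by rewrite (T_infinite 1 infW) raddf0 !mul0r.
case=> {x y} [l m lW mW||i j|i l lW|i l lW|i l lW|i l lW|i j ij m|i j ij m].
- rewrite [LHS]rmorphM /= !S_evalE -[LHS]rmorphM /= T_1_mul //.
  by case: ifP => _; rewrite ?S_evalE ?raddf0.
- have [finW|] := pselect (finite_set Wpi); last exact: T0.
  rewrite rmorph1 raddf_fsum // -(rmorph1 incl) -T_sum_1 // raddf_fsum //.
  by apply: eq_fsbigr => l _; exact: S_eval_o.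
- have [finW|] := pselect (finite_set Wpi); last exact: T0.
  rewrite [LHS]rmorphB /= [X in X - _ = _]rmorphM [X in _ - X = _]rmorphM /=.
  rewrite !S_evalE.
  rewrite -![incl _ * incl _]rmorphM -rmorphB /=.
  have [<-|ij] := eqVneq i j; last by rewrite T_EF_comm // subrr !raddf0.
  rewrite T_EF_sum // !raddf_fsum //; apply: eq_fsbigr => l _.
  rewrite [LHS]tensor_inclZ [RHS]S_evalZ S_evalE /=.
  by rewrite (qbin1 (vi_neq0 d i) (@vi_generic _ _ _ cartan i)).
- rewrite [LHS]rmorphM /= !S_evalE -[LHS]rmorphM /= T_E_slide.
  case: ifPn => aW; last by rewrite T_1_out // mul0r !raddf0.
  by rewrite [RHS]rmorphM /= !S_evalE -[RHS]rmorphM.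
- rewrite [LHS]rmorphM /= !S_evalE -[LHS]rmorphM /= T_F_slide.
  case: ifPn => aW; last by rewrite T_1_out // mul0r !raddf0.
  by rewrite [RHS]rmorphM /= !S_evalE -[RHS]rmorphM.
- have El : 1_l * e i 1 = e i 1 * 1_(l - alpha i) by rewrite T_E_slide subrK.
  rewrite [LHS]rmorphM /= !S_evalE -[LHS]rmorphM /= El.
  case: ifPn => aW; last by rewrite T_1_out // mulr0 !raddf0.
  by rewrite [RHS]rmorphM /= !S_evalE -[RHS]rmorphM.
- have Fl : 1_l * f i 1 = f i 1 * 1_(l + alpha i) by rewrite T_F_slide addrK.
  rewrite [LHS]rmorphM /= !S_evalE -[LHS]rmorphM /= Fl.
  case: ifPn => aW; last by rewrite T_1_out // mulr0 !raddf0.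
  by rewrite [RHS]rmorphM /= !S_evalE -[RHS]rmorphM.
- rewrite raddf0 [LHS]S_eval_serre !S_evalE.
  exact: (T_serre (T_e_exp i) (T_serreE C d pi ij)).
- rewrite raddf0 [LHS]S_eval_serre !S_evalE.
  exact: (T_serre (T_f_exp i) (T_serreF C d pi ij)).
Qed.

End TSide.

(** * The isomorphism *)

Section Isomorphism.
Variables (n : nat) (C : 'M[int]_n) (d : 'I_n -> nat) (pi : set (weight n)).
Hypothesis cartan : finite_cartan C d.
Local Notation rS := (@S_rel n C d pi).
Local Notation rT := (@T_rel n C d pi).
Local Notation S := (palg rS).
Local Notation T := (tensor zl_val (palg rT)).
Local Notation incl := (tensor_incl zl_val (rel := rT)).
Local Notation scal := (tensor_scalar zl_val rT).
Local Notation scal_central := (@tensor_scalar_central _ _ zl_val _ rT).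

Definition S_to_T : S -> T := palg_lift scal (@T_generator n C d pi) (rel := rS).
HB.instance Definition _ := GRing.isZmodMorphism.Build S T S_to_T
  (palg_lift_is_zmod_morphism scal_central
    (S_eval_rel cartan)).
HB.instance Definition _ := GRing.isMonoidMorphism.Build S T S_to_T
  (palg_lift_is_monoid_morphism scal_central
    (S_eval_rel cartan)).

Lemma S_to_T_pi x : S_to_T (ppi rS x) = S_eval d x.
Proof. exact: (palg_lift_pi scal_central (S_eval_rel cartan)). Qed.

Lemma S_to_TZ c u : S_to_T (c *: u) = c *: S_to_T u.
Proof.
rewrite [LHS](palg_liftZ scal_central (S_eval_rel cartan)).
exact: tensor_scalarE.
Qed.

Definition AT_to_S : palg rT -> S :=
  palg_lift (@S_scalar n C d pi) (@S_divided n C d pi) (rel := rT).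
HB.instance Definition _ := GRing.isZmodMorphism.Build (palg rT) S AT_to_S
  (palg_lift_is_zmod_morphism (@S_scalar_central n C d pi) (T_eval_rel cartan)).
HB.instance Definition _ := GRing.isMonoidMorphism.Build (palg rT) S AT_to_S
  (palg_lift_is_monoid_morphism (@S_scalar_central n C d pi) (T_eval_rel cartan)).

Lemma AT_to_S_pi x : AT_to_S (ppi rT x) = T_eval d x.
Proof. exact: (palg_lift_pi (@S_scalar_central n C d pi) (T_eval_rel cartan)). Qed.

Lemma AT_to_SZ c u : AT_to_S (c *: u) = zl_val c *: AT_to_S u.
Proof.
rewrite [LHS](palg_liftZ (@S_scalar_central n C d pi) (T_eval_rel cartan)).
exact: palg_scalarE.
Qed.

Definition T_to_S : T -> S := tensor_lift AT_to_S.

Lemma T_to_S_incl m : T_to_S (incl m) = AT_to_S m.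
Proof. by apply: tensor_lift_pure; [exact: raddfD | exact: AT_to_SZ]. Qed.

Lemma T_to_SD : {morph T_to_S : u w / u + w}.
Proof. by apply: tensor_liftD; [exact: raddfD | exact: AT_to_SZ]. Qed.

Lemma T_to_SZ : scalable T_to_S.
Proof. by apply: tensor_liftZ; [exact: raddfD | exact: AT_to_SZ]. Qed.

Lemma T_to_S0 : T_to_S 0 = 0.
Proof. by rewrite -(scale0r (1 : T)) T_to_SZ scale0r. Qed.

Lemma T_to_SM : {morph T_to_S : u w / u * w}.
Proof.
move=> u w; elim/tensor_pure_ind: u => [|u u' IHu IHu'|a m].
- by rewrite mul0r T_to_S0 mul0r.
- by rewrite mulrDl !T_to_SD IHu IHu' mulrDl.
elim/tensor_pure_ind: w => [|w w' IHw IHw'|b m'].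
- by rewrite mulr0 T_to_S0 mulr0.
- by rewrite mulrDr !T_to_SD IHw IHw' mulrDr.
rewrite -tensor_scalerAl -tensor_scalerAr !T_to_SZ.
rewrite -[pure zl_val 1 m]/(incl m) -[pure zl_val 1 m']/(incl m').
rewrite -(rmorphM incl) /= !T_to_S_incl rmorphM.
by rewrite -palg_scalerAl -palg_scalerAr.
Qed.

(** The quantum factorials are invertible in [Q(v)], so in [T] the generator
    [E_i^(a)] is determined by [E_i^a]. *)
Lemma AT_to_SK m : S_to_T (AT_to_S m) = incl m.
Proof.
elim/palg_gen_ind: m => [g||u w IHu IHw|u w IHu IHw|c u IHu].
- rewrite AT_to_S_pi; case: g => [[[i a]|[i a]]|l].
  + rewrite T_eval_e /dpow S_to_TZ rmorphXn /= S_to_T_pi S_eval_e.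
    rewrite (T_e_exp _ cartan) -tensor_scalarE mulrA -rmorphM.
    rewrite mulVf ?rmorph1 ?mul1r //.
    by apply: qfact_neq0; [exact: vi_neq0 | exact: vi_generic cartan i].
  + rewrite T_eval_f /dpow S_to_TZ rmorphXn /= S_to_T_pi S_eval_f.
    rewrite (T_f_exp _ cartan) -tensor_scalarE mulrA -rmorphM.
    rewrite mulVf ?rmorph1 ?mul1r //.
    by apply: qfact_neq0; [exact: vi_neq0 | exact: vi_generic cartan i].
  + rewrite [X in S_to_T X]free_lift_gen /= S_to_T_pi S_eval_o /T_o.
    by rewrite valK.
- by rewrite !rmorph1.
- by rewrite !rmorphD /= IHu IHw.
- by rewrite !rmorphM /= IHu IHw.
- by rewrite AT_to_SZ S_to_TZ IHu tensor_inclZ.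
Qed.

Lemma T_to_SK : cancel T_to_S S_to_T.
Proof.
elim/tensor_pure_ind => [|u w IHu IHw|a m].
- by rewrite T_to_S0 raddf0.
- by rewrite T_to_SD rmorphD /= IHu IHw.
- by rewrite T_to_SZ S_to_TZ T_to_S_incl AT_to_SK.
Qed.

Lemma S_to_TK : cancel S_to_T T_to_S.
Proof.
elim/palg_gen_ind=> [g||u w IHu IHw|u w IHu IHw|c u IHu].
- rewrite S_to_T_pi [S_eval _ _]free_lift_gen.
  case: g => [[i|i]|l]; rewrite T_to_S_incl AT_to_S_pi.
  + by rewrite T_eval_e dpow1 //; [exact: vi_neq0 | exact: vi_generic cartan i].
  + by rewrite T_eval_f dpow1 //; [exact: vi_neq0 | exact: vi_generic cartan i].
  + by rewrite T_eval_o /S_o valK.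
- by rewrite rmorph1 -(rmorph1 incl) T_to_S_incl rmorph1.
- by rewrite rmorphD T_to_SD IHu IHw.
- by rewrite rmorphM T_to_SM IHu IHw.
- by rewrite S_to_TZ T_to_SZ IHu.
Qed.

Local Notation AS := (@AS n C d pi).

(** With [AT_to_SK], this puts the image of [incl] inside the image of [AS]; the
    reverse inclusion is [S_to_T_AS]. *)
Lemma AS_AT_to_S m : AS (AT_to_S m).
Proof.
elim/palg_gen_ind: m => [g||u w IHu IHw|u w IHu IHw|c u IHu].
- rewrite AT_to_S_pi [T_eval _ _]free_lift_gen.
  case: g => [[[i a]|[i a]]|l]; [exact: AS_E | exact: AS_F |].
  by apply: AS_1; exact: valP.
- by rewrite rmorph1; exact: AS_one.
- by rewrite rmorphD; exact: AS_add.
- by rewrite rmorphM; exact: AS_mul.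
- by rewrite AT_to_SZ; exact: AS_scale.
Qed.

Lemma S_to_T_AS u : AS u -> exists m, S_to_T u = incl m.
Proof.
elim=> {u} [l lW|i m|i m||u w _ [x Ex] _ [y Ey]|u w _ [x Ex] _ [y Ey]|a u _ [x Ex]].
- by exists (ppi rT (T_o C pi l)); rewrite S_to_T_pi S_eval_o.
- exists (ppi rT (T_e C pi i m)); rewrite -AT_to_SK AT_to_S_pi T_eval_e //.
- exists (ppi rT (T_f C pi i m)); rewrite -AT_to_SK AT_to_S_pi T_eval_f //.
- by exists 1; rewrite !rmorph1.
- by exists (x + y); rewrite !rmorphD /= Ex Ey.
- by exists (x * y); rewrite !rmorphM /= Ex Ey.
- by exists (a *: x); rewrite S_to_TZ Ex tensor_inclZ.
Qed.

Lemma S_to_T_image : S_to_T @` AS = zspan (range incl).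
Proof.
apply/seteqP; split=> [_ [u /S_to_T_AS[m Em] <-]|w].
  by rewrite Em; apply: zspan_gen; exists m.
elim=> {w} [|_ [m _ <-]|x y _ [u Su <-] _ [w Sw <-]|a x _ [u Su <-]].
- exists 0; last exact: raddf0.
  by rewrite -(scale0r (1 : S)) -(rmorph0 zl_val); apply: AS_scale; exact: AS_one.
- by exists (AT_to_S m); [exact: AS_AT_to_S | exact: AT_to_SK].
- by exists (u + w); [exact: AS_add | exact: raddfD].
- by exists (zl_val a *: u); [exact: AS_scale | exact: S_to_TZ].
Qed.

Lemma S_to_T_linear : linear S_to_T.
Proof. by move=> a u w; rewrite rmorphD /= S_to_TZ. Qed.

Lemma S_to_T_monoid_morphism : monoid_morphism S_to_T.
Proof. by split=> [|u w]; [exact: rmorph1 | exact: rmorphM]. Qed.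
End Isomorphism.

Theorem theorem8p3 (n : nat) (C : 'M[int]_n) (d : 'I_n -> nat)
    (pi : set (weight n)) :
  finite_cartan C d ->
  finite_set pi ->
  (forall l, pi l -> dominant l) ->
  saturated C pi ->
  exists f : S_alg C d pi -> T_alg C d pi,
    [/\ [/\ linear f, monoid_morphism f & bijective f],
        [/\ forall i, f (S_E C d pi i) = T_E C d pi i,
            forall i, f (S_F C d pi i) = T_F C d pi i
          & forall l, l \in weyl_orbits C pi -> f (S_1 C d pi l) = T_1 C d pi l]
      & f @` @AS n C d pi = zspan (range (@T_incl n C d pi))].
Proof.
move=> cartan _ _ _; exists (@S_to_T n C d pi); split; [split|split|].
- exact: S_to_T_linear cartan.
- exact: S_to_T_monoid_morphism cartan.
- exact: Bijective (S_to_TK cartan) (T_to_SK cartan).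
- by move=> i; rewrite S_to_T_pi // S_eval_e.
- by move=> i; rewrite S_to_T_pi // S_eval_f.
- by move=> l _; rewrite S_to_T_pi // S_eval_o.
- exact: S_to_T_image cartan.
Qed.
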